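(* Let $H$ be a separable Hilbert space, let $A$ be a unital $C^*$-algebra and let $\alpha$ be a completely positive uniform algebra tensor norm. Then a closed subspace of the Banach algebra $A\otimes^\alpha K(H)$ is a Lie ideal if and only if it is a closed ideal and has the form $\overline{I\otimes K(H)}^{\alpha}$ for some closed ideal $I$ in $A$.
   Context: $K(H)$ denotes the compact operators on $H$. Here $\alpha$ assigns to each pair of $C^*$-algebras $A,B$ a norm $\|\cdot\|_\alpha$ on the algebraic tensor product $A\otimes B$; $A\otimes^\alpha B$ is the completion and $\overline{\,\cdot\,}^{\alpha}$ denotes closure in it. $\alpha$ is an algebra norm if $\|wz\|_\alpha\le\|w\|_\alpha\|z\|_\alpha$ for all $w,z\in A\otimes B$ (so that $A\otimes^\alpha B$ is a Banach algebra); it is a tensor norm if $\|\cdot\|_\lambda\le\|\cdot\|_\alpha\le\|\cdot\|_\gamma$, where $\lambda$ and $\gamma$ are the Banach space injective and projective tensor norms. A tensor norm $\alpha$ is completely positive uniform if for all completely positive maps $T_i:A_i\to B_i$ ($i=1,2$) between $C^*$-algebras, the map $T_1\otimes T_2:A_1\otimes A_2\to B_1\otimes B_2$ has a continuous extension $T_1\otimes^\alpha T_2:A_1\otimes^\alpha A_2\to B_1\otimes^\alpha B_2$ with $\|T_1\otimes^\alpha T_2\|\le\|T_1\|\|T_2\|$. A subspace $L$ of an algebra $C$ is a Lie ideal if $[c,x]:=cx-xc\in L$ for all $c\in C$, $x\in L$. Ideals are two-sided.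
   Formalization: H is assumed infinite-dimensional: for H finite-dimensional the claim fails, e.g. for A = ℂ and H = ℂ² the scalar multiples of the identity form a closed Lie ideal of M₂(ℂ) that is not an ideal. *)

(* Defs.v *)
From HB Require Import structures.
From mathcomp Require Import all_boot all_order all_algebra.
From mathcomp Require Import finmap complex.
From mathcomp Require Import sesquilinear.
From mathcomp Require Import boolp classical_sets functions cardinality reals.
From mathcomp Require Import topology normedtype sequences.
From mathcomp Require Import ring lra.
Set Implicit Arguments.
Unset Strict Implicit.
Unset Printing Implicit Defensive.
Import Order.TTheory GRing.Theory Num.Theory.
Import numFieldNormedType.Exports.
Local Open Scope classical_set_scope.
Local Open Scope ring_scope.

(* The inner product is linear in its first argument. *)
HB.mixin Record NormedModule_isHilbert (R : realType) H
    & CompleteNormedModule R[i] H := {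
  hdot : {dot H for (@Num.conj R[i])};
  hdot_norm : forall x : H, hdot x x = `|x| ^+ 2
}.

#[short(type="hilbertType")]
HB.structure Definition Hilbert (R : realType) :=
  {H of NormedModule_isHilbert R H & CompleteNormedModule R[i] H}.

(* C*-algebras need not be unital, so the product is not a library ring
   structure. *)
HB.mixin Record NormedModule_isCstarAlgebra (R : realType) A
    & CompleteNormedModule R[i] A := {
  cmul : A -> A -> A;
  cstar : A -> A;
  cmulA : associative cmul;
  cmulDl : left_distributive cmul +%R;
  cmulDr : right_distributive cmul +%R;
  cmulZl : forall (k : R[i]) x y, cmul (k *: x) y = k *: cmul x y;
  cmulZr : forall (k : R[i]) x y, cmul x (k *: y) = k *: cmul x y;
  cstarK : involutive cstar;
  cstarD : {morph cstar : x y / x + y};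
  cstarZ : forall (k : R[i]) x, cstar (k *: x) = k^* *: cstar x;
  cstarM : forall x y, cstar (cmul x y) = cmul (cstar y) (cstar x);
  cnormM : forall x y, `|cmul x y| <= `|x| * `|y|;
  cstar_norm : forall x, `|cmul (cstar x) x| = `|x| ^+ 2
}.

#[short(type="cstarAlgType")]
HB.structure Definition CstarAlgebra (R : realType) :=
  {A of NormedModule_isCstarAlgebra R A & CompleteNormedModule R[i] A}.

(* Norms of complex normed modules take values in R[i]; rnorm is the same norm
   read in R. *)
Definition rnorm (R : realType) (V : normedModType R[i]) (x : V) : R :=
  complex.Re `|x|.

Section RealNorm.
Variables (R : realType) (V : normedModType R[i]).
Implicit Types x y z : V.

Lemma rnormE x : `|x| = real_complex R (rnorm x).
Proof. by rewrite /rnorm RRe_real ?normr_real. Qed.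

Lemma rnorm_ge0 x : 0 <= rnorm x.
Proof. by have := normr_ge0 x; rewrite rnormE ler0c. Qed.

Lemma rnorm_le x y : (`|x| <= `|y|) = (rnorm x <= rnorm y).
Proof. by rewrite !rnormE lecR. Qed.

Lemma rnormD x y : rnorm (x + y) <= rnorm x + rnorm y.
Proof. by have := ler_normD x y; rewrite !rnormE -rmorphD lecR. Qed.

Lemma rnorm0 : rnorm (0 : V) = 0.
Proof. by rewrite /rnorm normr0. Qed.

Lemma rnormN x : rnorm (- x) = rnorm x.
Proof. by rewrite /rnorm normrN. Qed.

Lemma rnormC x y : rnorm (x - y) = rnorm (y - x).
Proof. by rewrite /rnorm distrC. Qed.

Lemma rnormZ (k : R[i]) x : rnorm (k *: x) = complex.Re `|k| * rnorm x.
Proof.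
have Hk : `|k| = real_complex R (complex.Re `|k|) by rewrite RRe_real ?normr_real.
by apply/(@complexI R); rewrite -rnormE normrZ Hk rnormE rmorphM.
Qed.

Lemma rnorm_eq0 x : rnorm x = 0 -> x = 0.
Proof. by move=> h; apply/normr0_eq0; rewrite rnormE h. Qed.

Lemma rnorm_tri y x z : rnorm (x - z) <= rnorm (x - y) + rnorm (y - z).
Proof. by have := rnormD (x - y) (y - z); rewrite addrA subrK. Qed.

Lemma rnorm_triB x y : rnorm x <= rnorm (x - y) + rnorm y.
Proof. by have := rnormD (x - y) y; rewrite subrK. Qed.

Lemma rnorm_ball x y (e : R) :
  ball x (real_complex R e) y <-> rnorm (x - y) < e.
Proof. by rewrite -ball_normE /ball_/= rnormE ltcR. Qed.

Lemma posCP (e : R[i]) : 0 < e -> exists2 r : R, 0 < r & e = real_complex R r.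
Proof.
move=> e0; exists (complex.Re e).
  by move: e0; rewrite ltcE => /andP[].
by rewrite RRe_real// gtr0_real.
Qed.

Definition rcauchy (u : nat -> V) := forall e : R, 0 < e ->
  exists N, forall m n, (N <= m)%N -> (N <= n)%N -> rnorm (u m - u n) < e.

Definition rcvg (u : nat -> V) (l : V) := forall e : R, 0 < e ->
  exists N, forall n, (N <= n)%N -> rnorm (u n - l) < e.

Lemma rcvgP (u : nat -> V) l : (u @ \oo --> l) <-> rcvg u l.
Proof.
split.
  move=> /cvgrPdist_lt ul e e0.
  have e0' : 0 < real_complex R e by rewrite ltcR.
  have [N _ HN] := ul _ e0'.
  by exists N => n /HN /=; rewrite distrC rnormE ltcR.
move=> ul; apply/cvgrPdist_lt => _ /posCP[e e0 ->].
have [N HN] := ul e e0.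
by exists N => // n /= /HN; rewrite distrC rnormE ltcR.
Qed.

Lemma rcvg_uniq u l l' : rcvg u l -> rcvg u l' -> l = l'.
Proof.
move=> ul ul'; apply/eqP; rewrite -subr_eq0; apply/eqP/rnorm_eq0.
apply/eqP; rewrite eq_le rnorm_ge0 andbT; apply/ler_addgt0Pl => e e0.
have e2 : 0 < e / 2 by lra.
have [N hN] := ul _ e2; have [M hM] := ul' _ e2.
have := hN _ (leq_maxl N M); have := hM _ (leq_maxr N M).
have := rnorm_tri (u (maxn N M)) l l'; rewrite (rnormC l (u _)).
lra.
Qed.

Lemma rcvg_cauchy u l : rcvg u l -> rcauchy u.
Proof.
move=> ul e e0; have e2 : 0 < e / 2 by lra.
have [N hN] := ul _ e2; exists N => m n /hN hm /hN hn.
have := rnorm_tri l (u m) (u n); rewrite (rnormC l).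
lra.
Qed.

Lemma small_inv (e : R) : 0 < e ->
  exists N, forall n, (N <= n)%N -> n.+1%:R^-1 < e.
Proof.
move=> e0; exists (Num.truncn e^-1) => n Nn.
rewrite invf_plt ?posrE// (lt_le_trans (truncnS_gt _))// ler_nat.
by rewrite ltnS.
Qed.

Lemma rcauchy_complete :
  (forall u, rcauchy u -> exists l, rcvg u l) ->
  forall F : set_system V, ProperFilter F -> cauchy F -> cvg F.
Proof.
move=> H F PF /cauchyP Fex.
have /choice[u uF] : forall n : nat, exists x, F (ball x (real_complex R n.+1%:R^-1)).
  by move=> n; apply: Fex; rewrite ltcR invr_gt0.
have uC : rcauchy u.
  move=> e e0; have e2 : 0 < e / 2 by lra.
  have [N hN] := small_inv e2; exists N => m n /hN hm /hN hn.
  have [z [/rnorm_ball zm /rnorm_ball zn]] := filter_ex (filterI (uF m) (uF n)).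
  have {hm}zm := lt_trans zm hm; have {hn}zn := lt_trans zn hn.
  have := rnorm_tri z (u m) (u n); rewrite (rnormC z); lra.
have [l ul] := H u uC.
apply/cvg_ex; exists l; apply/cvgrPdist_lt => _ /posCP[e e0 ->].
have e2 : 0 < e / 2 by lra.
have [N hN] := small_inv e2; have [M hM] := ul _ e2.
have k1 := hN _ (leq_maxl N M); have k2 := hM _ (leq_maxr N M).
apply: filterS (uF (maxn N M)) => x /rnorm_ball kx.
have {k1}kx := lt_trans kx k1.
rewrite rnormE ltcR.
have := rnorm_tri (u (maxn N M)) l x; rewrite (rnormC l (u _)); lra.
Qed.

End RealNorm.

Lemma rcauchy_cvg (R : realType) (V : completeNormedModType R[i]) (u : nat -> V) :
  rcauchy u -> exists l, rcvg u l.
Proof.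
move=> uC; suff /cauchy_cvg/cvg_ex[l /rcvgP ul] : cauchy (u @ \oo) by exists l.
apply/cauchyP => _ /posCP[e e0 ->].
have [N hN] := uC _ e0; exists (u N); exists N => // n /= Nn.
by apply/rnorm_ball/hN.
Qed.

Section TotallyBounded.
Variables (R : realType).

Definition totbounded (V : normedModType R[i]) (S : set V) :=
  forall e : R, 0 < e ->
  exists s : seq V, forall y, S y -> exists2 c, c \in s & rnorm (y - c) < e.

Lemma ultra_big (T : Type) (F : set_system T) (I : eqType) (s : seq I)
    (f : I -> set T) (S : set T) : UltraFilter F -> F S ->
  (forall y, S y -> exists2 c, c \in s & f c y) -> exists2 c, c \in s & F (f c).
Proof.
move=> FU; elim: s S => [|a s IH] S FS Sf.
  by have [y /Sf[]] := filter_ex FS.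
have [Fa|Fna] := in_ultra_setVsetC (f a) FU.
  by exists a => //; rewrite mem_head.
have [y [Sy nay]|c cs Fc] := IH _ (filterI FS Fna).
  have [c] := Sf _ Sy; rewrite inE => /predU1P[->|cs fcy]; first by [].
  by exists c.
by exists c => //; rewrite inE cs orbT.
Qed.

Lemma precompactP (V : completeNormedModType R[i]) (S : set V) :
  precompact S <-> totbounded S.
Proof.
rewrite precompactE; split.
  rewrite compact_cover => cS e e0.
  have e0' : 0 < real_complex R e by rewrite ltcR.
  have [||D _ SD] := cS V setT (fun x => ball x (real_complex R e)).
  - by move=> x _; apply: ball_open.
  - by move=> x _; exists x => //; apply: ballxx.
  exists (enum_fset D) => y /subset_closure /SD [c /= cD /rnorm_ball].
  by rewrite rnormC => yc; exists c.
move=> tS; rewrite compact_ultra => F FU FS.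
have Fc : cauchy F.
  apply/cauchyP => _ /posCP[e e0 ->].
  have e2 : 0 < e / 2 by lra.
  have [s sP] := tS _ e2.
  have [|c _ Fc] := @ultra_big _ F _ s
      (fun c => ball c (real_complex R e)) _ FU FS; last by exists c.
  move=> y Sy; have e2' : 0 < real_complex R (e / 2) by rewrite ltcR.
  have [z [/sP[c cs zc] /rnorm_ball yz]] := Sy _ (nbhsx_ballx y _ e2').
  exists c => //; apply/rnorm_ball; rewrite rnormC.
  have := rnorm_tri z y c; lra.
have [l Fl] : exists l : V, F --> l by apply/cvg_ex; apply: cauchy_cvg.
exists l; split => //.
apply: (@closed_closure _ S) => B /Fl/= FB.
by have [z [Sz Bz]] := filter_ex (filterI FS FB); exists z.
Qed.

Lemma totbounded_sub (V : normedModType R[i]) (S S' : set V) :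
  S `<=` S' -> totbounded S' -> totbounded S.
Proof. by move=> SS tS e /tS[s sP]; exists s => y /SS/sP. Qed.

Lemma totbounded_pull (T : Type) (D : set T) (V W : normedModType R[i])
    (g : T -> V) (f : T -> W) :
  (forall e : R, 0 < e -> exists2 d : R, 0 < d &
     forall x y, D x -> D y -> rnorm (g x - g y) < d -> rnorm (f x - f y) < e) ->
  totbounded (g @` D) -> totbounded (f @` D).
Proof.
move=> gf tg e /gf[d d0 {}gf].
have d2 : 0 < d / 2 by lra.
have [s sP] := tg _ d2.
have [k kP] : exists k : V -> W, forall c x, D x -> rnorm (g x - c) < d / 2 ->
    rnorm (f x - k c) < e.
  suff /choice[k kP] : forall c, exists w, forall x, D x ->
      rnorm (g x - c) < d / 2 -> rnorm (f x - w) < e by exists k.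
  move=> c; have [[y [Dy yc]]|n] :=
    pselect (exists y, D y /\ rnorm (g y - c) < d / 2); last first.
    by exists 0 => x Dx xc; exfalso; apply: n; exists x.
  exists (f y) => x Dx xc; apply: gf => //.
  have := rnorm_tri c (g x) (g y); rewrite (rnormC c); lra.
exists (map k s) => _ [x Dx <-].
have [|c cs xc] := sP (g x); first by exists x.
by exists (k c); [apply: map_f|apply: kP].
Qed.

Lemma totboundedD (T : Type) (D : set T) (V : normedModType R[i])
    (f g : T -> V) : totbounded (f @` D) -> totbounded (g @` D) ->
  totbounded ((fun x => f x + g x) @` D).
Proof.
move=> tf tg e e0; have e2 : 0 < e / 2 by lra.
have [s sP] := tf _ e2; have [t tP] := tg _ e2.
exists [seq x + y | x <- s, y <- t] => _ [x Dx <-].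
have [|c cs xc] := sP (f x); first by exists x.
have [|d dt xd] := tP (g x); first by exists x.
exists (c + d); first by apply/allpairsP; exists (c, d).
have := rnormD (f x - c) (g x - d).
by rewrite opprD addrACA; lra.
Qed.

Lemma totbounded_bounded (V : normedModType R[i]) (S : set V) :
  totbounded S -> exists2 M : R, 0 <= M & forall x, S x -> rnorm x <= M.
Proof.
move=> /(_ 1 ltr01)[s sP].
exists (1 + \sum_(c <- s) rnorm c).
  by rewrite addr_ge0// sumr_ge0// => c _; apply: rnorm_ge0.
move=> x /sP[c cs xc].
rewrite (perm_big _ (perm_to_rem cs)) big_cons.
set B := (X in _ + (_ + X)).
have B0 : 0 <= B by rewrite sumr_ge0// => ? _; apply: rnorm_ge0.
rewrite addrA; apply: (le_trans (rnorm_triB x c)).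
have := rnorm_ge0 c; move: xc B0; move: (rnorm _) (rnorm c) => a b; lra.
Qed.

End TotallyBounded.

Section OperatorNorm.
Variables (R : realType) (V W : normedModType R[i]).
Implicit Types T : V -> W.

(* Meaningful for bounded T only: sup of an unbounded set is 0. *)
Definition opnorm T : R := sup [set rnorm (T x) | x in [set x : V | `|x| <= 1]].

Lemma unit_ballE (x : V) : (`|x| <= 1) = (rnorm x <= 1).
Proof. by rewrite rnormE -lecR. Qed.

Definition bddby T (M : R) := forall x, rnorm (T x) <= M * rnorm x.

Variable T : V -> W.
Hypothesis linT : linear T.

Lemma linf0 : T 0 = 0.
Proof. by have := linT (-1) 0 0; rewrite scaler0 addr0 scaleN1r addNr. Qed.

Lemma linfD x y : T (x + y) = T x + T y.
Proof. by have := linT 1 x y; rewrite !scale1r. Qed.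

Lemma linfZ k x : T (k *: x) = k *: T x.
Proof. by have := linT k x 0; rewrite linf0 !addr0. Qed.

Lemma linfN x : T (- x) = - T x.
Proof. by rewrite -scaleN1r linfZ scaleN1r. Qed.

Lemma linfB x y : T (x - y) = T x - T y.
Proof. by rewrite linfD linfN. Qed.

Lemma bddby_ball (M : R) :
  (forall x, rnorm x <= 1 -> rnorm (T x) <= M) -> bddby T M.
Proof.
move=> TM x; have [x0|x0] := eqVneq (rnorm x) 0.
  by rewrite x0 (rnorm_eq0 x0) linf0 rnorm0 mulr0.
have xp : 0 < rnorm x by rewrite lt0r x0 rnorm_ge0.
pose k := real_complex R (rnorm x)^-1.
have kE : complex.Re `|k| = (rnorm x)^-1.
  by rewrite ger0_norm// ler0c invr_ge0 ltW.
have := TM (k *: x); rewrite linfZ !rnormZ kE mulVf// lexx => /(_ isT).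
by rewrite mulrC ler_pdivrMr.
Qed.

Lemma opnorm_has_sup M : bddby T M ->
  has_sup [set rnorm (T x) | x in [set x : V | `|x| <= 1]].
Proof.
move=> TM; split; first by exists (rnorm (T 0)), 0 => //=; rewrite unit_ballE rnorm0.
exists `|M| => _ [x + <-]; rewrite /mkset unit_ballE => x1.
apply: le_trans (TM x) _; apply: le_trans (ler_norm _) _.
by rewrite normrM (ger0_norm (rnorm_ge0 x)) ler_piMr.
Qed.

Lemma opnorm_ge0 M : bddby T M -> 0 <= opnorm T.
Proof.
move=> TM; apply: ub_le_sup; first by case: (opnorm_has_sup TM).
by exists 0; rewrite /= ?unit_ballE ?rnorm0// linf0 rnorm0.
Qed.

Lemma opnorm_bddby M : bddby T M -> bddby T (opnorm T).
Proof.
move=> TM; apply: bddby_ball => x x1.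
apply: ub_le_sup; first by case: (opnorm_has_sup TM).
by exists x; rewrite //= unit_ballE.
Qed.

Lemma opnorm_le M : 0 <= M -> bddby T M -> opnorm T <= M.
Proof.
move=> M0 TM; apply: ge_sup; first by case: (opnorm_has_sup TM).
move=> _ [x + <-]; rewrite /mkset unit_ballE => x1.
by apply: le_trans (TM x) _; rewrite ler_piMr.
Qed.

End OperatorNorm.

Section LimitLinear.
Variables (R : realType) (V : normedModType R[i]).

Lemma rcvgD (u v : nat -> V) a b : rcvg u a -> rcvg v b ->
  rcvg (fun n => u n + v n) (a + b).
Proof.
move=> ua vb e e0; have e2 : 0 < e / 2 by lra.
have [N hN] := ua _ e2; have [M hM] := vb _ e2.
exists (maxn N M) => n; rewrite geq_max => /andP[/hN h1 /hM h2].
have := rnormD (u n - a) (v n - b); rewrite addrACA -opprD; lra.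
Qed.

Lemma rcvgZ k (u : nat -> V) a : rcvg u a -> rcvg (fun n => k *: u n) (k *: a).
Proof.
move=> ua e e0.
have k0 : 0 <= complex.Re `|k| by exact: (@rnorm_ge0 R R[i]^o k).
have e2 : 0 < e / (complex.Re `|k| + 1) by rewrite divr_gt0//; lra.
have [N hN] := ua _ e2; exists N => n /hN.
rewrite -scalerBr rnormZ ltr_pdivlMr; last by lra.
have := rnorm_ge0 (u n - a); nra.
Qed.

Lemma rcvg_ext (u v : nat -> V) l : (forall n, u n = v n) -> rcvg u l -> rcvg v l.
Proof. by move=> uv; rewrite (_ : u = v)//; apply/funext. Qed.

Lemma rcvg_norm_le (u : nat -> V) l M :
  rcvg u l -> (exists N, forall n, (N <= n)%N -> rnorm (u n) <= M) ->
  rnorm l <= M.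
Proof.
move=> ul [N uM]; apply/ler_addgt0Pl => e e0; have [K hK] := ul _ e0.
have := uM _ (leq_maxl N K); have := hK _ (leq_maxr N K).
have := rnorm_triB l (u (maxn N K)); rewrite (rnormC l); lra.
Qed.

End LimitLinear.

Section HilbertTheory.
Variables (R : realType) (H : hilbertType R).
Implicit Types x y z : H.

Definition rdot x y : R := complex.Re (hdot x y).

Lemma hdotDl x y z : hdot (x + y) z = hdot x z + hdot y z.
Proof. by rewrite linearDl. Qed.

Lemma hdotC x y : hdot x y = (hdot y x)^*.
Proof. by rewrite hermC expr0 mul1r. Qed.

Lemma hdotZl (k : R[i]) x y : hdot (k *: x) y = k * hdot x y.
Proof. by rewrite linearZl_LR. Qed.

Lemma ReD (a b : R[i]) : complex.Re (a + b) = complex.Re a + complex.Re b.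
Proof. by case: a b => [? ?] [? ?]. Qed.

Lemma Re_conj (a : R[i]) : complex.Re (a^*) = complex.Re a.
Proof. by case: a. Qed.

Lemma rdotDl x y z : rdot (x + y) z = rdot x z + rdot y z.
Proof. by rewrite /rdot hdotDl ReD. Qed.

Lemma rdotC x y : rdot x y = rdot y x.
Proof. by rewrite /rdot hdotC Re_conj. Qed.

Lemma rdotDr x y z : rdot x (y + z) = rdot x y + rdot x z.
Proof. by rewrite !(rdotC x) rdotDl. Qed.

Lemma rdotZl (k : R) x y : rdot (real_complex R k *: x) y = k * rdot x y.
Proof. by rewrite /rdot hdotZl; case: (hdot x y) => a b /=; rewrite mul0r subr0. Qed.

Lemma rdotZr (k : R) x y : rdot x (real_complex R k *: y) = k * rdot x y.
Proof. by rewrite !(rdotC x) rdotZl. Qed.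

Lemma rdotNl x y : rdot (- x) y = - rdot x y.
Proof.
rewrite -scaleN1r (_ : -1 = real_complex R (-1)) ?rdotZl ?mulN1r//.
by rewrite rmorphN1.
Qed.

Lemma rdotBl x y z : rdot (x - y) z = rdot x z - rdot y z.
Proof. by rewrite rdotDl rdotNl. Qed.

Lemma rdot_norm x : rdot x x = rnorm x ^+ 2.
Proof.
by apply/(@complexI R); rewrite rmorphXn/= -rnormE -hdot_norm /rdot hdot_norm
  rnormE -rmorphXn.
Qed.

Lemma rnorm_sqD x y : rnorm (x + y) ^+ 2 =
  rnorm x ^+ 2 + 2 * rdot x y + rnorm y ^+ 2.
Proof. rewrite -!rdot_norm rdotDl !rdotDr (rdotC y x); ring. Qed.

Lemma rdot_le x y : rdot x y <= rnorm x * rnorm y.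
Proof.
have [y0|y0] := eqVneq (rnorm y) 0.
  rewrite y0 mulr0 (rnorm_eq0 y0) rdotC -(scale0r 0).
  by rewrite (_ : 0 = real_complex R 0)// rdotZl mul0r.
have yp : 0 < rnorm y by rewrite lt0r y0 rnorm_ge0.
have [x0|x0] := eqVneq (rnorm x) 0.
  rewrite x0 mul0r (rnorm_eq0 x0) -(scale0r 0).
  by rewrite (_ : 0 = real_complex R 0)// rdotZl mul0r.
have xp : 0 < rnorm x by rewrite lt0r x0 rnorm_ge0.
have := rnorm_sqD (real_complex R (rnorm y) *: x) (- (real_complex R (rnorm x) *: y)).
rewrite rdotZl (rdotC x) rdotNl rdotZl (rdotC y) rnormN !rnormZ.
have nE (t : R) : 0 <= t -> complex.Re `|real_complex R t| = t.
  by move=> t0; rewrite ger0_norm// ler0c.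
rewrite !nE ?rnorm_ge0// => E.
have := sqr_ge0 (rnorm (real_complex R (rnorm y) *: x - real_complex R (rnorm x) *: y)).
rewrite {}E; move: (rnorm x) (rnorm y) (rdot x y) xp yp => a b c a0 b0 h.
have ab : 0 < a * b by rewrite mulr_gt0.
rewrite -subr_ge0 -(pmulr_rge0 _ ab).
have -> : a * b * (a * b - c) = ((b * a) ^+ 2 + 2 * (b * - (a * c)) + (a * b) ^+ 2) / 2.
  by field.
by rewrite divr_ge0// (le_trans h)// le_eqVlt; apply/orP; left; apply/eqP; ring.
Qed.

Lemma rdot_abs x y : `|rdot x y| <= rnorm x * rnorm y.
Proof.
rewrite ler_norml rdot_le andbT lerNl -rdotNl.
by rewrite (le_trans (rdot_le _ _))// rnormN.
Qed.

Lemma Re_i (a : R[i]) : complex.Re (complex.Complex 0 1 * a) = - complex.Im a.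
Proof. by case: a => a b /=; rewrite mul0r mul1r sub0r. Qed.

Lemma hdot_ext (f g : H -> R[i]) :
  (forall x, f (complex.Complex 0 1 *: x) = complex.Complex 0 1 * f x) ->
  (forall x, g (complex.Complex 0 1 *: x) = complex.Complex 0 1 * g x) ->
  (forall x, complex.Re (f x) = complex.Re (g x)) -> f =1 g.
Proof.
move=> fi gi fg x; have h := fg x; have := fg (complex.Complex 0 1 *: x).
rewrite fi gi !Re_i => /oppr_inj h'.
by move: h h'; case: (f x) (g x) => [a b] [c d] /= -> ->.
Qed.

Lemma hdot_nondeg y z : (forall x, rdot x y = rdot x z) -> y = z.
Proof.
move=> h; apply/eqP; rewrite -subr_eq0; apply/eqP/rnorm_eq0/eqP.
rewrite -sqrf_eq0 -rdot_norm.
by rewrite rdotBl !(rdotC _ (y - z)) h subrr.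
Qed.

Lemma ltr_addl (a b c : R) : a < b -> c + a < c + b.
Proof. by rewrite ltrD2l. Qed.

Section Riesz.
Variables (g : H -> R) (M : R).
Hypothesis gD : forall x y, g (x + y) = g x + g y.
Hypothesis gZ : forall (k : R) x, g (real_complex R k *: x) = k * g x.
Hypothesis gM : forall x, `|g x| <= M * rnorm x.

Let phi x := rnorm x ^+ 2 - 2 * g x.

Let S := [set phi x | x in [set: H]].

Let S_lb : has_lbound S.
Proof.
exists (- M ^+ 2) => _ [x _ <-]; rewrite /phi.
have := gM x; rewrite ler_norml => /andP[_].
move: (rnorm x) (g x) => a b ab.
have := sqr_ge0 (a - M); rewrite sqrrB -mulr_natr; lra.
Qed.

Let m := inf S.

Let phi_ge x : m <= phi x.
Proof. by apply: ge_inf => //; exists x. Qed.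

Let phi_seq : exists u : nat -> H, forall n, phi (u n) < m + n.+1%:R^-1.
Proof.
suff /choice[u uP] : forall n : nat, exists x, phi x < m + n.+1%:R^-1 by exists u.
move=> n; have [||_ [x _ <-] h] := @inf_adherent R S n.+1%:R^-1.
- by rewrite invr_gt0.
- by split=> //; exists (phi 0), 0.
- by exists x.
Qed.

Let phi_mid x y : rnorm (x - y) ^+ 2 <= 2 * (phi x + phi y) - 4 * m.
Proof.
have := phi_ge (real_complex R 2^-1 *: (x + y)).
rewrite /phi gZ gD -!rdot_norm rdotZl rdotZr !rdotDl !rdotDr rdotNl.
rewrite !(rdotC _ (- y)) !rdotNl (rdotC y x) (rdotC y (- y)) rdotNl.
move: (rdot x x) (rdot x y) (rdot y y) (g x) (g y) => a b c d e; lra.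
Qed.

Lemma riesz_real : exists z, forall x, g x = rdot x z.
Proof.
have [u uP] := phi_seq.
have uC : rcauchy u.
  move=> e e0; have e2 : 0 < e ^+ 2 / 4 by rewrite divr_gt0// exprn_gt0.
  have [N hN] := small_inv e2; exists N => i j /hN hi /hN hj.
  have := phi_mid (u i) (u j).
  have {hi}hi := lt_trans (uP i) (ltr_addl m hi).
  have {hj}hj := lt_trans (uP j) (ltr_addl m hj).
  have := rnorm_ge0 (u i - u j).
  rewrite -(ltr_pXn2r (n := 2)) ?nnegrE ?rnorm_ge0 ?(ltW e0)//.
  move: hi hj; move: (phi _) (phi _) (rnorm _) (e ^+ 2) => a b c d; lra.
have [z uz] := rcauchy_cvg uC.
exists z => x.
set c := g x - rdot x z.
have q0 := rnorm_ge0 x; set q := rnorm x ^+ 2.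
have qge : 0 <= q by rewrite sqr_ge0.
have key (t : R) : 0 <= t ^+ 2 * q - 2 * t * c.
  apply/ler_addgt0Pr => e e0.
  pose k := 2 * `|t| * rnorm x + 1.
  have k0 : 0 < k by rewrite ltr_wpDl// !mulr_ge0.
  have e2 : 0 < e / 2 by lra.
  have e3 : 0 < e / 2 / k by rewrite divr_gt0.
  have [N hN] := small_inv e2; have [N' hN'] := uz _ e3.
  have h1 := hN _ (leq_maxl N N'); have h2 := hN' _ (leq_maxr N N').
  set n := maxn N N' in h1 h2.
  have h3 := phi_ge (u n + real_complex R t *: x).
  have h4 := lt_trans (uP n) (ltr_addl m h1).
  have h5 : phi (u n + real_complex R t *: x) =
      phi (u n) + 2 * t * rdot (u n) x + t ^+ 2 * q - 2 * t * g x.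
    rewrite /phi gD gZ rnorm_sqD rdotZr /q -!rdot_norm rdotZl rdotZr; ring.
  have h6 : 2 * t * (rdot (u n) x - rdot z x) <= e / 2.
    rewrite -rdotBl (le_trans (ler_norm _))// !normrM (ger0_norm (_ : 0 <= 2))//.
    apply: (@le_trans _ _ (2 * `|t| * (rnorm (u n - z) * rnorm x))).
      by rewrite ler_wpM2l ?rdot_abs// mulr_ge0.
    have := rnorm_ge0 (u n - z); move: h2; rewrite ltr_pdivlMr// /k.
    have : 0 <= 2 * `|t| * rnorm x by rewrite !mulr_ge0.
    move: (rnorm (u n - z)) => r; move: (`|t|) (rnorm x) => a b; nra.
  rewrite h5 in h3; rewrite /c (rdotC x z).
  move: h6 h3 h4; move: (rdot (u n) x) (rdot z x) (g x) (phi _) => r s w p.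
  lra.
suff : c = 0 by rewrite /c => /eqP; rewrite subr_eq0 => /eqP.
have := key (c / (q + 1)).
have q1 : 0 < q + 1 by lra.
have -> : (c / (q + 1)) ^+ 2 * q - 2 * (c / (q + 1)) * c =
  - (c ^+ 2 * (q + 2) / (q + 1) ^+ 2) by field; rewrite gt_eqF.
rewrite oppr_ge0 pmulr_lle0 ?invr_gt0 ?exprn_gt0// pmulr_lle0; last by lra.
by rewrite le_eqVlt ltNge sqr_ge0 orbF sqrf_eq0 => /eqP.
Qed.

End Riesz.

Section Adjoint.
Variable T : H -> H.

Definition adjoint (y : H) : H :=
  xget 0 [set z | forall x, hdot (T x) y = hdot x z].

Hypothesis linT : linear T.
Variable M : R.
Hypothesis bT : bddby T M.

Lemma adjoint_spec x y : hdot (T x) y = hdot x (adjoint y).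
Proof.
move: x; rewrite /adjoint; case: xgetP => [z -> //|noz].
have [z zP] : exists z, forall x, rdot (T x) y = rdot x z.
  apply: (@riesz_real (fun x => rdot (T x) y) (M * rnorm y)).
  - by move=> a b; rewrite (linfD linT) rdotDl.
  - by move=> k a; rewrite (linfZ linT) rdotZl.
  - move=> a; rewrite (le_trans (rdot_abs _ _))//.
    by rewrite mulrAC ler_wpM2r ?rnorm_ge0.
exfalso; apply: (noz z) => /=; apply: hdot_ext => //.
  by move=> x; rewrite (linfZ linT) hdotZl.
by move=> x; rewrite hdotZl.
Qed.

Lemma adjoint_rdot x y : rdot (T x) y = rdot x (adjoint y).
Proof. by rewrite /rdot adjoint_spec. Qed.

Lemma adjoint_uniq y z : (forall x, hdot (T x) y = hdot x z) -> adjoint y = z.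
Proof.
by move=> h; apply: hdot_nondeg => x; rewrite /rdot -adjoint_spec h.
Qed.

Lemma adjoint_linear : linear adjoint.
Proof.
move=> k y z; apply: adjoint_uniq => x.
rewrite hdotC hdotDl hdotZl [RHS]hdotC hdotDl hdotZl.
by rewrite !(hdotC _ (T x)) !adjoint_spec -!(hdotC (adjoint _)).
Qed.

Lemma adjoint_bddby : 0 <= M -> bddby adjoint M.
Proof.
move=> M0 y; have [->|n0] := eqVneq (rnorm (adjoint y)) 0.
  by rewrite mulr_ge0 ?rnorm_ge0.
have p0 : 0 < rnorm (adjoint y) by rewrite lt0r n0 rnorm_ge0.
rewrite -(ler_pM2l p0) -expr2 -rdot_norm -adjoint_rdot.
rewrite (le_trans (rdot_le _ _))//.
by rewrite mulrCA mulrA ler_wpM2r ?rnorm_ge0 ?bT.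
Qed.

End Adjoint.

End HilbertTheory.

Section CompactOperators.
Variables (R : realType) (H : hilbertType R).

Definition compact_operator (T : H -> H) : Prop :=
  linear T /\ precompact (T @` [set x : H | `|x| <= 1]).

Definition compactop_pred : {pred H -> H} := fun T => `[< compact_operator T >].

Record compactop := Compactop {
  compactop_fun :> H -> H;
  compactopP : compactop_fun \in compactop_pred
}.

HB.instance Definition _ := [isSub for compactop_fun].
HB.instance Definition _ := [Choice of compactop by <:].

Lemma compactP (T : H -> H) : compact_operator T <->
  linear T /\ totbounded (T @` [set x : H | `|x| <= 1]).
Proof. by split=> -[? /precompactP]. Qed.

Lemma compact_bddby (T : H -> H) : compact_operator T ->
  exists2 M : R, 0 <= M & bddby T M.
Proof.
move=> /compactP[lT /totbounded_bounded[M M0 MP]]; exists M => //.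
apply: bddby_ball => // x x1; apply: MP.
by exists x; rewrite //= unit_ballE.
Qed.

Lemma comp_linear (S T : H -> H) : linear S -> linear T -> linear (S \o T).
Proof. by move=> lS lT k x y /=; rewrite lT lS. Qed.

Lemma compact_postcomp (S T : H -> H) (M : R) : linear S -> 0 <= M -> bddby S M ->
  compact_operator T -> compact_operator (S \o T).
Proof.
move=> lS M0 bS /compactP[lT tT]; apply/compactP; split.
  exact: comp_linear.
apply: totbounded_pull tT => e e0; exists (e / (M + 1)).
  by rewrite divr_gt0//; lra.
move=> x y _ _ /=; rewrite -(linfB lS) ltr_pdivlMr; last by lra.
have := bS (T x - T y); have := rnorm_ge0 (T x - T y); nra.
Qed.

Lemma compactop_submod : GRing.submod_closed compactop_pred.
Proof.
split.
  apply/asboolP/compactP; split; first by move=> k x y /=; rewrite scaler0 addr0.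
  move=> e e0; exists [:: 0] => _ [x _ <-]; exists 0; first exact: mem_head.
  by rewrite subr0 rnorm0.
move=> k S T /asboolP cS /asboolP /compactP[lT tT]; apply/asboolP/compactP.
have lk : linear (fun x : H => k *: x).
  by move=> a x y; rewrite scalerDr !scalerA mulrC.
have /compactP[lkS tkS] : compact_operator ((fun x => k *: x) \o S).
  apply: (@compact_postcomp _ _ (complex.Re `|k|)) => //.
    exact: (@rnorm_ge0 R R[i]^o k).
  by move=> x; rewrite rnormZ.
split; last exact: totboundedD tkS tT.
move=> a x y; have := lkS a x y; rewrite /= => h.
rewrite -[LHS]/(k *: S (a *: x + y) + T (a *: x + y)) h lT.
rewrite -[RHS]/(a *: (k *: S x + T x) + (k *: S y + T y)).
by rewrite scalerDr addrACA.
Qed.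

HB.instance Definition _ := GRing.isSubmodClosed.Build R[i] (H -> H)
  compactop_pred compactop_submod.
HB.instance Definition _ := [SubChoice_isSubLmodule of compactop by <:].

Implicit Types S T U : compactop.

Lemma compactop_spec T : compact_operator T.
Proof. exact/asboolP/compactopP. Qed.

Lemma compactop_linear T : linear T.
Proof. by have [] := compactop_spec T. Qed.

Lemma compactop_bddby T : bddby T (opnorm T).
Proof.
have [M _ bM] := compact_bddby (compactop_spec T).
exact: opnorm_bddby (compactop_linear T) _ bM.
Qed.

Lemma compactop_norm0 T : 0 <= opnorm T.
Proof. exact: opnorm_ge0 (compactop_linear T) _ (@compactop_bddby T). Qed.

Lemma compactop_normle T M : 0 <= M -> bddby T M -> opnorm T <= M.
Proof. exact: opnorm_le. Qed.

Lemma compactop_addE S T x : (S + T) x = S x + T x.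
Proof. by []. Qed.

Lemma compactop_subE S T x : (S - T) x = S x - T x.
Proof. by []. Qed.

Lemma compactop_scaleE (k : R[i]) T x : (k *: T) x = k *: T x.
Proof. by []. Qed.

Lemma compactop_ext S T : (forall x, S x = T x) -> S = T.
Proof. by move=> h; apply/val_inj/funext. Qed.

Let normC T : R[i] := real_complex R (opnorm T).

Let normCD S T : normC (S + T) <= normC S + normC T.
Proof.
rewrite /normC -rmorphD lecR; apply: compactop_normle.
  by rewrite addr_ge0// compactop_norm0.
move=> x; rewrite compactop_addE (le_trans (rnormD _ _))// mulrDl.
by rewrite lerD// compactop_bddby.
Qed.

Let normCZ_le (k : R[i]) T : opnorm (k *: T) <= complex.Re `|k| * opnorm T.
Proof.
have k0 : 0 <= complex.Re `|k| by exact: (@rnorm_ge0 R R[i]^o k).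
apply: compactop_normle; first by rewrite mulr_ge0 ?compactop_norm0.
by move=> x; rewrite compactop_scaleE rnormZ -mulrA ler_wpM2l// compactop_bddby.
Qed.

Let normCZ (k : R[i]) T : normC (k *: T) = `|k| * normC T.
Proof.
have kE : `|k| = real_complex R (complex.Re `|k|) by rewrite RRe_real ?normr_real.
rewrite /normC kE -rmorphM; congr (real_complex R _).
apply/eqP; rewrite eq_le normCZ_le andTb.
have [->|k0] := eqVneq k 0.
  by rewrite normr0 mul0r compactop_norm0.
have kp : 0 < complex.Re `|k| by rewrite -ltcR -kE normr_gt0.
have := normCZ_le k^-1 (k *: T); rewrite scalerA mulVf// scale1r.
rewrite normrV ?unitfE// kE -fmorphV/=.
by rewrite -ler_pdivrMl ?invr_gt0// invrK.
Qed.

Let normC0 T : normC T = 0 -> T = 0.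
Proof.
move=> /(@complexI R) T0; apply: compactop_ext => x; apply: rnorm_eq0.
apply/eqP; rewrite eq_le rnorm_ge0 andbT.
by have := compactop_bddby T x; rewrite T0 mul0r.
Qed.

HB.instance Definition _ :=
  Lmodule_isNormed.Build R[i] compactop normCD normCZ normC0.

Lemma compactop_rnorm T : rnorm T = opnorm T.
Proof. by []. Qed.

Lemma compactop_complete (u : nat -> compactop) :
  rcauchy u -> exists l, rcvg u l.
Proof.
move=> uC.
have uxC x : rcauchy (fun n => u n x).
  move=> e e0; have x1 : 0 < rnorm x + 1 by rewrite ltr_wpDl ?rnorm_ge0.
  have e1 : 0 < e / (rnorm x + 1) by rewrite divr_gt0.
  have [N hN] := uC _ e1; exists N => m n hm hn.
  have := hN _ _ hm hn; rewrite compactop_rnorm ltr_pdivlMr//.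
  have := compactop_bddby (u m - u n) x; rewrite compactop_subE.
  have := compactop_norm0 (u m - u n); nra.
have /choice[f fP] : forall x, exists y, rcvg (fun n => u n x) y.
  by move=> x; apply: rcauchy_cvg.
have lf : linear f.
  move=> k x y; apply: rcvg_uniq (fP _) _.
  apply: (rcvg_ext _ (rcvgD (rcvgZ k (fP x)) (fP y))) => n.
  by rewrite compactop_linear.
have near e : 0 < e -> exists N, forall n, (N <= n)%N ->
    bddby (fun x => u n x - f x) e.
  move=> e0; have [N hN] := uC _ e0; exists N => n Nn x.
  apply/ler_addgt0Pr => d d0; have [K hK] := fP x _ d0.
  have := hN _ _ Nn (leq_maxl N K); have := hK _ (leq_maxr N K).
  rewrite compactop_rnorm; set v := u (maxn N K).
  have := compactop_bddby (u n - v) x; rewrite compactop_subE.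
  have := rnorm_tri (v x) (u n x) (f x); have := rnorm_ge0 x.
  have := compactop_norm0 (u n - v); nra.
have cf : compact_operator f.
  apply/compactP; split => // e e0.
  have e2 : 0 < e / 2 by lra.
  have [N /(_ _ (leqnn N)) hN] := near _ e2.
  have [_ /(_ _ e2)[s sP]] := (compactP (u N)).1 (compactop_spec _).
  exists s => _ [x x1 <-].
  have [|c cs xc] := sP (u N x); first by exists x.
  exists c => //; have := hN x.
  move: x1; rewrite /= unit_ballE => x1.
  have := rnorm_tri (u N x) (f x) c; rewrite (rnormC (f x) (u N x)).
  have := rnorm_ge0 x; nra.
have fM : f \in compactop_pred by apply/asboolP.
exists (Compactop fM) => e e0; have e2 : 0 < e / 2 by lra.
have [N hN] := near _ e2; exists N => n /hN bn.
rewrite compactop_rnorm (@le_lt_trans _ _ (e / 2))//; last by lra.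
by apply: compactop_normle; [exact: ltW|exact: bn].
Qed.

HB.instance Definition _ :=
  Uniform_isComplete.Build compactop (rcauchy_complete compactop_complete).

Definition kmul S T : compactop.
Proof.
exists (S \o T); apply/asboolP.
exact: compact_postcomp (compactop_linear S) (compactop_norm0 S)
  (@compactop_bddby S) (compactop_spec T).
Defined.

Lemma compact_adjoint T : compact_operator (adjoint T).
Proof.
have lT := compactop_linear T; have bT := @compactop_bddby T.
have ba := adjoint_bddby lT bT (compactop_norm0 T).
have la := adjoint_linear lT bT.
apply/compactP; split => //.
have tTa : totbounded ((T \o adjoint T) @` [set x : H | `|x| <= 1]).
  set M := opnorm T in ba; have M0 := compactop_norm0 T.
  pose k := real_complex R (M + 1)^-1.
  have M1 : 0 < M + 1 by rewrite ltr_wpDl.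
  have tT : totbounded (T @` [set x : H | `|x| <= 1]).
    by have [] := (compactP T).1 (compactop_spec T).
  apply: (@totbounded_sub _ _ _ ((fun y => real_complex R (M + 1) *: y) @`
    (T @` [set x : H | `|x| <= 1]))).
    move=> _ [x /= x1 <-]; exists (T (k *: adjoint T x)).
      exists (k *: adjoint T x) => //=; rewrite unit_ballE rnormZ.
      rewrite ger0_norm ?ler0c ?invr_ge0 ?(ltW M1)//= ler_pdivrMl// mulr1.
      move: x1; rewrite unit_ballE; have := ba x; have := rnorm_ge0 x; nra.
    rewrite (linfZ lT) scalerA -rmorphM mulfV ?gt_eqF//.
    by rewrite rmorph1 scale1r.
  rewrite image_comp; apply: totbounded_pull tT => e e0.
  exists (e / (M + 1)); first by rewrite divr_gt0.
  move=> x y _ _ /=; rewrite -scalerBr rnormZ ger0_norm ?ler0c ?(ltW M1)//=.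
  by rewrite ltr_pdivlMr// mulrC.
apply: totbounded_pull tTa => e e0; exists (e ^+ 2 / 4).
  by rewrite divr_gt0// exprn_gt0.
move=> x y; rewrite /mkset !unit_ballE => x1 y1 /=.
rewrite -(linfB lT) -(linfB la) => h.
rewrite -(@ltr_pXn2r _ 2) ?nnegrE ?rnorm_ge0 ?(ltW e0)//.
rewrite -rdot_norm -(adjoint_rdot lT bT) (le_lt_trans (rdot_le _ _))//.
have := rnormD x (- y); rewrite rnormN.
have := rnorm_ge0 (T (adjoint T (x - y))); have := rnorm_ge0 (x - y); nra.
Qed.

Definition kstar T : compactop :=
  Compactop (introT (asboolP _) (@compact_adjoint T)).

Let kadj S x y : hdot (S x) y = hdot x (kstar S y).
Proof. exact (adjoint_spec (compactop_linear S) (@compactop_bddby S) x y). Qed.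

Let kadj_uniq S T : (forall x y, hdot (S x) y = hdot x (T y)) -> kstar S = T.
Proof.
move=> h; apply: compactop_ext => y.
exact (adjoint_uniq (compactop_linear S) (@compactop_bddby S) (h^~ y)).
Qed.

Let hdotDr (x y z : H) : hdot x (y + z) = hdot x y + hdot x z.
Proof. by rewrite linearDr. Qed.

Let hdotZr (k : R[i]) (x y : H) : hdot x (k *: y) = k^* * hdot x y.
Proof. by rewrite linearZr_LR. Qed.

Let kmulA : associative kmul.
Proof. by move=> S T U; apply: compactop_ext. Qed.

Let kmulDl : left_distributive kmul +%R.
Proof. by move=> S T U; apply: compactop_ext. Qed.

Let kmulDr : right_distributive kmul +%R.
Proof.
by move=> S T U; apply: compactop_ext => x; apply: linfD (compactop_linear S) _ _.
Qed.

Let kmulZl (k : R[i]) S T : kmul (k *: S) T = k *: kmul S T.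
Proof. exact: compactop_ext. Qed.

Let kmulZr (k : R[i]) S T : kmul S (k *: T) = k *: kmul S T.
Proof.
by apply: compactop_ext => x; apply: linfZ (compactop_linear S) _ _.
Qed.

Let kstarK : involutive kstar.
Proof.
by move=> S; apply: kadj_uniq => x y; rewrite hdotC -kadj -hdotC.
Qed.

Let kstarD : {morph kstar : S T / S + T}.
Proof.
move=> S T; apply: kadj_uniq => x y.
by rewrite !compactop_addE hdotDl hdotDr !kadj.
Qed.

Let kstarZ (k : R[i]) S : kstar (k *: S) = k^* *: kstar S.
Proof.
apply: kadj_uniq => x y.
by rewrite !compactop_scaleE hdotZl hdotZr conjCK kadj.
Qed.

Let kstarM S T : kstar (kmul S T) = kmul (kstar T) (kstar S).
Proof. by apply: kadj_uniq => x y; rewrite /= -!kadj. Qed.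

Let knormM_le S T : opnorm (kmul S T) <= opnorm S * opnorm T.
Proof.
apply: compactop_normle; first by rewrite mulr_ge0 ?compactop_norm0.
move=> x /=; rewrite (le_trans (compactop_bddby S _))// -mulrA.
by rewrite ler_wpM2l ?compactop_norm0 ?compactop_bddby.
Qed.

Let knormM S T : `|kmul S T| <= `|S| * `|T|.
Proof. by rewrite !rnormE !compactop_rnorm -rmorphM lecR. Qed.

Let kstar_norm S : `|kmul (kstar S) S| = `|S| ^+ 2.
Proof.
rewrite !rnormE !compactop_rnorm -rmorphXn; congr (real_complex R _).
have s0 := compactop_norm0 S; have p0 := compactop_norm0 (kmul (kstar S) S).
have bS : opnorm (kstar S) <= opnorm S.
  apply: compactop_normle => //.
  exact (adjoint_bddby (compactop_linear S) (@compactop_bddby S) s0).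
apply/eqP; rewrite eq_le; apply/andP; split.
  by rewrite (le_trans (knormM_le _ _))// expr2 ler_wpM2r.
rewrite -[leRHS]sqr_sqrtr// ler_pXn2r ?nnegrE ?sqrtr_ge0//.
apply: compactop_normle; rewrite ?sqrtr_ge0// => x.
rewrite -(@ler_pXn2r _ 2) ?nnegrE ?mulr_ge0 ?rnorm_ge0 ?sqrtr_ge0//.
rewrite exprMn sqr_sqrtr// -rdot_norm /rdot.
rewrite kadj -/(rdot x _) (le_trans (rdot_le _ _))//.
have := compactop_bddby (kmul (kstar S) S) x => /= h.
by rewrite mulrC expr2 mulrA ler_wpM2r ?rnorm_ge0.
Qed.

HB.instance Definition _ := NormedModule_isCstarAlgebra.Build R compactop
  kmulA kmulDl kmulDr kmulZl kmulZr kstarK kstarD kstarZ kstarM knormM kstar_norm.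

End CompactOperators.
Arguments compactop {R} H.

Section Completion.
Variables (R : realType) (V : normedModType R[i]).

Definition rcauchy_pred : {pred nat -> V} := fun u => `[< rcauchy u >].

Record cauchyseq := Cauchyseq {
  cauchyseq_fun :> nat -> V;
  cauchyseqP : cauchyseq_fun \in rcauchy_pred
}.

HB.instance Definition _ := [isSub for cauchyseq_fun].
HB.instance Definition _ := [Choice of cauchyseq by <:].

Lemma rcauchy_submod : GRing.submod_closed rcauchy_pred.
Proof.
split; first by apply/asboolP => e e0; exists 0%N => m n _ _; rewrite subrr rnorm0.
move=> k u v /asboolP uC /asboolP vC; apply/asboolP => e e0.
have k0 : 0 <= complex.Re `|k| by exact: (@rnorm_ge0 R R[i]^o k).
have e2 : 0 < e / 2 by lra.
have e3 : 0 < e / 2 / (complex.Re `|k| + 1) by rewrite divr_gt0//; lra.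
have [N hN] := uC _ e3; have [M hM] := vC _ e2.
exists (maxn N M) => m n; rewrite !geq_max => /andP[m1 m2] /andP[n1 n2].
have := hN _ _ m1 n1; rewrite ltr_pdivlMr; last by lra.
have := hM _ _ m2 n2.
rewrite -[(k *: u + v) m]/(k *: u m + v m) -[(k *: u + v) n]/(k *: u n + v n).
rewrite opprD addrACA -scalerBr.
have := rnormD (k *: (u m - u n)) (v m - v n); rewrite rnormZ.
have := rnorm_ge0 (u m - u n); nra.
Qed.

HB.instance Definition _ := GRing.isSubmodClosed.Build R[i] (nat -> V)
  rcauchy_pred rcauchy_submod.
HB.instance Definition _ := [SubChoice_isSubLmodule of cauchyseq by <:].

Implicit Types u v : cauchyseq.

Lemma cauchyseq_spec u : rcauchy u.
Proof. exact/asboolP/(cauchyseqP u). Qed.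

Definition nullseq_pred : {pred cauchyseq} := fun u => `[< rcvg u 0 >].

Lemma nullseq_zmod : zmod_closed nullseq_pred.
Proof.
split; first by apply/asboolP => e e0; exists 0%N => n _; rewrite subr0 rnorm0.
move=> u v /asboolP u0 /asboolP v0; apply/asboolP.
have := rcvgD u0 (rcvgZ (-1) v0); rewrite scaler0 addr0.
by apply: rcvg_ext => n; rewrite scaleN1r.
Qed.

HB.instance Definition _ := GRing.isZmodClosed.Build cauchyseq nullseq_pred nullseq_zmod.

(* Cauchy sequences modulo null sequences. *)
Definition completion := Quotient.quot nullseq_pred.

HB.instance Definition _ := GRing.Zmodule.on completion.
HB.instance Definition _ := EqQuotient.on completion.

Let cpi u : completion := \pi_completion%qT u.

Let cpiP (x : completion) : exists u, x = cpi u.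
Proof. by exists (repr x); rewrite /cpi reprK. Qed.

Let cpi_eq u v : rcvg (u - v) 0 -> cpi u = cpi v.
Proof.
by move=> uv; apply/eqP; rewrite -Quotient.idealrBE; apply/asboolP.
Qed.

Let cpi_eq0 u : cpi u = 0 -> rcvg u 0.
Proof.
move=> u0; have : u - 0 \in nullseq_pred.
  by rewrite Quotient.idealrBE -/(cpi u) u0; apply/eqP; rewrite raddf0.
by rewrite subr0 => /asboolP.
Qed.

Let cpiD u v : cpi (u + v) = cpi u + cpi v.
Proof. exact: raddfD. Qed.

Let cpiB u v : cpi (u - v) = cpi u - cpi v.
Proof. exact: raddfB. Qed.

Let cscale (k : R[i]) (x : completion) : completion := cpi (k *: repr x).

Let cscale_pi k u : cscale k (cpi u) = cpi (k *: u).
Proof.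
apply: cpi_eq; rewrite -scalerBr.
have /cpi_eq0 h : cpi (repr (cpi u) - u) = 0.
  by rewrite cpiB /cpi reprK subrr.
by have := rcvgZ k h; rewrite scaler0.
Qed.

Let cscalerA a b x : cscale a (cscale b x) = cscale (a * b) x.
Proof. by have [u ->] := cpiP x; rewrite !cscale_pi scalerA. Qed.

Let cscale1r : left_id 1 cscale.
Proof. by move=> x; have [u ->] := cpiP x; rewrite !cscale_pi scale1r. Qed.

Let cscalerDr : right_distributive cscale +%R.
Proof.
move=> k x y; have [u ->] := cpiP x; have [v ->] := cpiP y.
by rewrite -cpiD !cscale_pi scalerDr cpiD.
Qed.

Let cscalerDl x : {morph cscale^~ x : a b / a + b}.
Proof. by move=> a b; have [u ->] := cpiP x; rewrite !cscale_pi scalerDl cpiD. Qed.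

HB.instance Definition _ := GRing.Zmodule_isLmodule.Build R[i] completion
  cscalerA cscale1r cscalerDr cscalerDl.

Let cpiZ k u : cpi (k *: u) = k *: cpi u.
Proof. by rewrite -cscale_pi. Qed.

Let rnorm_dist (x y : V) : `|rnorm x - rnorm y| <= rnorm (x - y).
Proof.
rewrite ler_norml; have := rnorm_triB x y; have := rnorm_triB y x.
rewrite (rnormC y x); lra.
Qed.

Let norm_cvg u : cvgn (fun n => rnorm (u n)).
Proof.
apply: cauchy_cvg; apply/cauchyP => e e0.
have [N hN] := cauchyseq_spec u e0; exists (rnorm (u N)); exists N => // n /= Nn.
by rewrite -ball_normE /ball_/=; apply: le_lt_trans (rnorm_dist _ _) (hN _ _ _ _).
Qed.

Let slim u : R := limn (fun n => rnorm (u n)).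

Let slimP u : (fun n => rnorm (u n)) @ \oo --> slim u.
Proof. exact: norm_cvg. Qed.

Let slim_le u M : (exists N, forall n, (N <= n)%N -> rnorm (u n) <= M) -> slim u <= M.
Proof.
move=> [N hN]; apply: limr_le; first exact: norm_cvg.
by exists N => // n /= /hN.
Qed.

Let slim_ge0 u : 0 <= slim u.
Proof.
apply: limr_ge; first exact: norm_cvg.
by apply: nearW => n; apply: rnorm_ge0.
Qed.

Let slimD u v : slim (u + v) <= slim u + slim v.
Proof.
have h : (fun n => rnorm (u n) + rnorm (v n)) @ \oo --> slim u + slim v.
  by apply: cvgD; apply: slimP.
rewrite -(cvg_lim _ h)//; apply: ler_lim; first exact: norm_cvg.
  by apply/cvg_ex; eexists; exact: h.
by apply: nearW => n; apply: rnormD.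
Qed.

Let slimZ (k : R[i]) u : slim (k *: u) = complex.Re `|k| * slim u.
Proof.
have h : (fun n => complex.Re `|k| * rnorm (u n)) @ \oo --> complex.Re `|k| * slim u.
  by apply: cvgMr; apply: norm_cvg.
rewrite -(cvg_lim _ h)//; congr (lim (_ @ \oo)); apply/funext => n.
by rewrite -rnormZ.
Qed.

Let slim0 u : rcvg u 0 <-> slim u = 0.
Proof.
split.
  move=> u0; apply/eqP; rewrite eq_le slim_ge0 andbT.
  apply/ler_addgt0Pl => e e0; rewrite addr0; apply: slim_le.
  by have [N hN] := u0 _ e0; exists N => n /hN; rewrite subr0 => /ltW.
move=> u0 e e0.
have : (fun n => rnorm (u n)) @ \oo --> (0 : R) by rewrite -u0; exact: norm_cvg.
move=> /cvgrPdist_lt /(_ _ e0)[N _ hN]; exists N => n /hN /=.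
by rewrite sub0r normrN subr0 ger0_norm// rnorm_ge0.
Qed.

Let cnorm (x : completion) : R := slim (repr x).

Let cnorm_pi u : cnorm (cpi u) = slim u.
Proof.
have h u1 u2 : cpi u1 = cpi u2 -> slim u1 <= slim u2.
  move=> e12; rewrite -[u1](subrK u2) (le_trans (slimD _ _))//.
  rewrite gerDr le_eqVlt; apply/orP; left; apply/eqP/slim0/cpi_eq0.
  by rewrite cpiB e12 subrr.
by apply/eqP; rewrite eq_le !h// /cpi reprK.
Qed.

Let cnormC (x : completion) : R[i] := real_complex R (cnorm x).

Let cnormCD x y : cnormC (x + y) <= cnormC x + cnormC y.
Proof.
have [u ->] := cpiP x; have [v ->] := cpiP y.
by rewrite /cnormC -rmorphD lecR -cpiD !cnorm_pi slimD.
Qed.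

Let cnormCZ (k : R[i]) x : cnormC (k *: x) = `|k| * cnormC x.
Proof.
have kE : `|k| = real_complex R (complex.Re `|k|) by rewrite RRe_real ?normr_real.
have [u ->] := cpiP x; rewrite /cnormC -cpiZ !cnorm_pi slimZ.
by rewrite [in RHS]kE -rmorphM.
Qed.

Let cnormC0 x : cnormC x = 0 -> x = 0.
Proof.
have [u ->] := cpiP x; move=> /(@complexI R); rewrite cnorm_pi => /slim0 u0.
have -> : 0 = cpi 0 by rewrite /cpi raddf0.
by apply: cpi_eq; rewrite subr0.
Qed.

HB.instance Definition _ :=
  Lmodule_isNormed.Build R[i] completion cnormCD cnormCZ cnormC0.

Let rnorm_pi u : rnorm (cpi u) = slim u.
Proof. by rewrite -cnorm_pi. Qed.

Let const_cauchy (x : V) : (fun _ : nat => x) \in rcauchy_pred.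
Proof. by apply/asboolP => e e0; exists 0%N => m n _ _; rewrite subrr rnorm0. Qed.

Definition compl_embed (x : V) : completion := cpi (Cauchyseq (const_cauchy x)).

Lemma compl_embed_linear : linear compl_embed.
Proof.
move=> k x y; rewrite /compl_embed -cpiZ -cpiD; congr cpi.
by apply/val_inj/funext.
Qed.

HB.instance Definition _ :=
  GRing.isLinear.Build R[i] V completion _ compl_embed compl_embed_linear.

Lemma compl_embed_rnorm x : rnorm (compl_embed x) = rnorm x.
Proof. by rewrite rnorm_pi /slim; apply: cvg_lim => //=; exact: (@cvg_cst R). Qed.

Lemma compl_embed_norm x : `|compl_embed x| = `|x|.
Proof. by rewrite !rnormE compl_embed_rnorm. Qed.

Let embed_near u : rcvg (fun n => compl_embed (u n)) (cpi u).
Proof.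
move=> e e0; have e2 : 0 < e / 2 by lra.
have [N hN] := cauchyseq_spec u e2; exists N => n Nn.
rewrite -cpiB rnorm_pi (@le_lt_trans _ _ (e / 2))//; last by lra.
by apply: slim_le; exists N => m Nm; apply/ltW/hN.
Qed.

Lemma completion_complete (f : nat -> completion) :
  rcauchy f -> exists l, rcvg f l.
Proof.
move=> fC.
have /choice[v vP] : forall n : nat, exists x, rnorm (f n - compl_embed x) < n.+1%:R^-1.
  move=> n; have [u ->] := cpiP (f n).
  have n0 : 0 < n.+1%:R^-1 :> R by rewrite invr_gt0.
  have [N /(_ _ (leqnn N)) hN] := embed_near u n0; exists (u N).
  by rewrite rnormC.
have vC : rcauchy v.
  move=> e e0; have e3 : 0 < e / 3 by lra.
  have [N hN] := small_inv e3; have [M hM] := fC _ e3.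
  exists (maxn N M) => m n; rewrite !geq_max => /andP[m1 m2] /andP[n1 n2].
  have k1 := lt_trans (vP m) (hN _ m1); have k2 := lt_trans (vP n) (hN _ n1).
  have k3 := hM _ _ m2 n2; move: k1 k2 k3.
  rewrite -compl_embed_rnorm linearB.
  have := rnorm_tri (f m) (compl_embed (v m)) (compl_embed (v n)).
  have := rnorm_tri (f n) (f m) (compl_embed (v n)).
  rewrite (rnormC (compl_embed (v m)) (f m)); lra.
have vM : v \in rcauchy_pred by apply/asboolP.
exists (cpi (Cauchyseq vM)) => e e0; have e2 : 0 < e / 2 by lra.
have [N hN] := small_inv e2; have [M hM] := embed_near (Cauchyseq vM) e2.
exists (maxn N M) => n; rewrite !geq_max => /andP[m1 m2].
have k1 := lt_trans (vP n) (hN _ m1); have := hM _ m2 => /=.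
have := rnorm_tri (compl_embed (v n)) (f n) (cpi (Cauchyseq vM)); lra.
Qed.

HB.instance Definition _ :=
  Uniform_isComplete.Build completion (rcauchy_complete completion_complete).

Lemma compl_embed_seq (x : completion) : exists u : nat -> V,
  rcvg (fun n => compl_embed (u n)) x.
Proof. by have [u ->] := cpiP x; exists u; apply: embed_near. Qed.

Lemma compl_embed_dense : dense (range compl_embed).
Proof.
move=> O [x Ox] oO; have [u /rcvgP ux] := compl_embed_seq x.
have [N _ /(_ _ (leqnn N)) hN] := ux _ (open_nbhs_nbhs (conj oO Ox)).
by exists (compl_embed (u N)); split => //; exists (u N).
Qed.

End Completion.

Section ExtendProduct.
Variables (R : realType) (V : normedModType R[i]).

(* Extension of a bounded bilinear product m to the completion by continuity:
   compl_mulP and compl_mul_embed below justify the definition. *)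
Definition compl_mul (m : V -> V -> V) (x y : completion V) : completion V :=
  xget 0 [set z | forall u v : nat -> V,
    (fun n => compl_embed (u n)) @ \oo --> x ->
    (fun n => compl_embed (v n)) @ \oo --> y ->
    (fun n => compl_embed (m (u n) (v n))) @ \oo --> z].

Variable m : V -> V -> V.
Hypothesis mDl : forall x y z, m (x + y) z = m x z + m y z.
Hypothesis mDr : forall x y z, m x (y + z) = m x y + m x z.
Hypothesis mle : forall x y, rnorm (m x y) <= rnorm x * rnorm y.

Let mB x x' y y' : m x y - m x' y' = m (x - x') y + m x' (y - y').
Proof.
have h1 := mDl (x - x') x' y; have h2 := mDr x' (y - y') y'.
rewrite !subrK in h1 h2.
by rewrite h1 h2 addrA addrK.
Qed.

Let emb_rcauchy (u : nat -> V) x : rcvg (fun n => compl_embed (u n)) x ->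
  exists2 M : R, 0 < M & exists N, forall n, (N <= n)%N -> rnorm (u n) <= M.
Proof.
move=> ux; exists (1 + rnorm x); first by rewrite ltr_pwDl ?rnorm_ge0.
have [N hN] := ux _ ltr01; exists N => n /hN.
have := rnorm_triB (compl_embed (u n)) x; rewrite compl_embed_rnorm; lra.
Qed.

Let emb_close (u u' : nat -> V) x e : 0 < e ->
  rcvg (fun n => compl_embed (u n)) x -> rcvg (fun n => compl_embed (u' n)) x ->
  exists N, forall n n', (N <= n)%N -> (N <= n')%N -> rnorm (u n - u' n') < e.
Proof.
move=> e0 ux ux'; have e2 : 0 < e / 2 by lra.
have [N hN] := ux _ e2; have [M hM] := ux' _ e2; exists (maxn N M) => n n'.
rewrite !geq_max => /andP[/hN h1 _] /andP[_ /hM h2].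
rewrite -compl_embed_rnorm linearB.
have := rnorm_tri x (compl_embed (u n)) (compl_embed (u' n')).
rewrite (rnormC x); lra.
Qed.

Let mul_close (u u' v v' : nat -> V) x y e : 0 < e ->
  rcvg (fun n => compl_embed (u n)) x -> rcvg (fun n => compl_embed (u' n)) x ->
  rcvg (fun n => compl_embed (v n)) y -> rcvg (fun n => compl_embed (v' n)) y ->
  exists N, forall n n', (N <= n)%N -> (N <= n')%N ->
    rnorm (m (u n) (v n) - m (u' n') (v' n')) < e.
Proof.
move=> e0 ux ux' vy vy'.
have [A A0 [N1 h1]] := emb_rcauchy vy; have [B B0 [N2 h2]] := emb_rcauchy ux'.
have eA : 0 < e / 2 / A by rewrite !divr_gt0.
have eB : 0 < e / 2 / B by rewrite !divr_gt0.
have [N3 h3] := emb_close eA ux ux'; have [N4 h4] := emb_close eB vy vy'.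
exists (maxn (maxn N1 N2) (maxn N3 N4)) => n n'.
rewrite !geq_max => /andP[/andP[/h1 k1 _] /andP[n3 n4]].
move=> /andP[/andP[_ /h2 k2] /andP[n3' n4']].
have := h3 _ _ n3 n3'; rewrite ltr_pdivlMr// => k3.
have := h4 _ _ n4 n4'; rewrite ltr_pdivlMr// => k4.
rewrite mB (le_lt_trans (rnormD _ _))//.
have k5 := mle (u n - u' n') (v n); have k6 := mle (u' n') (v n - v' n').
have g1 := rnorm_ge0 (u n - u' n'); have g2 := rnorm_ge0 (v n - v' n').
have k7 := le_trans k5 (ler_wpM2l g1 k1).
have k8 := le_trans k6 (ler_wpM2r g2 k2).
rewrite (mulrC B) in k8; lra.
Qed.

Lemma compl_mulP (x y : completion V) (u v : nat -> V) :
  (fun n => compl_embed (u n)) @ \oo --> x ->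
  (fun n => compl_embed (v n)) @ \oo --> y ->
  (fun n => compl_embed (m (u n) (v n))) @ \oo --> compl_mul m x y.
Proof.
rewrite /compl_mul; case: xgetP => [z -> h|noz]; first exact: h.
exfalso.
have [u0 u0x] := compl_embed_seq x; have [v0 v0y] := compl_embed_seq y.
have [e e0|z hz] := @rcauchy_cvg _ _ (fun n => compl_embed (m (u0 n) (v0 n))).
  have [N hN] := mul_close e0 u0x u0x v0y v0y.
  by exists N => i j hi hj; rewrite -linearB compl_embed_rnorm; apply: hN.
apply: (noz z) => u' v' /rcvgP ux /rcvgP vy; apply/rcvgP => e e0.
have e2 : 0 < e / 2 by lra.
have [N hN] := mul_close e2 ux u0x vy v0y; have [M hM] := hz _ e2.
exists (maxn N M) => n; rewrite geq_max => /andP[n1 n2].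
have := hN _ _ n1 n1; rewrite -compl_embed_rnorm linearB; have := hM _ n2.
set a := compl_embed (m (u' n) _); set b := compl_embed (m (u0 n) _).
have := rnorm_tri b a z; lra.
Qed.

Lemma compl_mul_embed (x y : V) :
  compl_mul m (compl_embed x) (compl_embed y) = compl_embed (m x y).
Proof.
have c (z : V) : rcvg (fun _ => compl_embed z) (compl_embed z).
  by move=> e e0; exists 0%N => n _; rewrite subrr rnorm0.
apply: (rcvg_uniq _ (c (m x y))); apply/rcvgP.
by apply: (compl_mulP (u := fun _ => x) (v := fun _ => y)); apply/rcvgP/c.
Qed.

End ExtendProduct.

Section TensorProduct.
Variables (K : fieldType) (U V : lmodType K).

(* The algebraic tensor product is realized as the space of functionals on
   bilinear forms spanned by the evaluations phi |-> phi u v; over a field this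
   is the usual tensor product. *)
Definition bilform := {bilinear U -> V -> K | *%R & *%R}.

Definition mkbilform (f : U -> V -> K)
    (fl : forall v, scalar (f^~ v)) (fr : forall u, scalar (f u)) : bilform :=
  HB.pack f (@bilinear_isBilinear.Build K U V K *%R *%R f (fl, fr)).

Definition pure_tensor (u : U) (v : V) : bilform -> K^o := fun phi => phi u v.

Definition tensor_pred : {pred bilform -> K^o} := fun t =>
  `[< exists s : seq (U * V), t = \sum_(p <- s) pure_tensor p.1 p.2 >].

Record tensor := Tensor {
  tensor_fun :> bilform -> K^o;
  tensorP : tensor_fun \in tensor_pred
}.

HB.instance Definition _ := [isSub for tensor_fun].
HB.instance Definition _ := [Choice of tensor by <:].

Lemma tensor_submod : GRing.submod_closed tensor_pred.
Proof.
split; first by apply/asboolP; exists [::]; rewrite big_nil.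
move=> k t t' /asboolP[s ->] /asboolP[s' ->]; apply/asboolP.
exists ([seq (k *: p.1, p.2) | p <- s] ++ s').
rewrite big_cat big_map/= scaler_sumr; congr (_ + _); apply: eq_bigr => p _.
by apply/funext => phi; rewrite /pure_tensor linearZl_LR.
Qed.

HB.instance Definition _ := GRing.isSubmodClosed.Build K (bilform -> K^o)
  tensor_pred tensor_submod.
HB.instance Definition _ := [SubChoice_isSubLmodule of tensor by <:].

Lemma pure_tensorP u v : pure_tensor u v \in tensor_pred.
Proof. by apply/asboolP; exists [:: (u, v)]; rewrite big_seq1. Qed.

Definition tens u v : tensor := Tensor (pure_tensorP u v).

Definition tensor_sum (s : seq (U * V)) : tensor := \sum_(p <- s) tens p.1 p.2.

Lemma tensor_sumP (t : tensor) : exists s, t = tensor_sum s.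
Proof.
have /asboolP[s ts] := tensorP t; exists s; apply: val_inj.
by rewrite /tensor_sum raddf_sum.
Qed.

Lemma tensor_sumE s (phi : bilform) : tensor_sum s phi = \sum_(p <- s) phi p.1 p.2.
Proof.
elim: s => [|p s IH]; first by rewrite /tensor_sum !big_nil.
by rewrite /tensor_sum !big_cons -IH.
Qed.

Lemma tensor_ext (t : tensor) (phi psi : bilform) : phi =2 psi -> t phi = t psi.
Proof.
by move=> h; have [s ->] := tensor_sumP t; rewrite !tensor_sumE; apply: eq_bigr.
Qed.

Lemma tensor_eqP (t t' : tensor) : (forall phi, t phi = t' phi) -> t = t'.
Proof. by move=> h; apply/val_inj/funext. Qed.

End TensorProduct.

Section TensorMap.
Variables (K : fieldType) (U V U' V' : lmodType K).
Variables (S : {linear U -> U'}) (T : {linear V -> V'}).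

Lemma tmap_subl (phi : bilform U' V') v : scalar (fun u => phi (S u) (T v)).
Proof. by move=> k x y; rewrite linearP linearDl linearZl_LR. Qed.

Lemma tmap_subr (phi : bilform U' V') u : scalar (fun v => phi (S u) (T v)).
Proof. by move=> k x y; rewrite linearP linearDr linearZr_LR. Qed.

Definition tmap_fun (t : tensor U V) : bilform U' V' -> K^o :=
  fun phi => t (mkbilform (tmap_subl phi) (tmap_subr phi)).

Lemma tmap_subproof t : tmap_fun t \in (@tensor_pred K U' V').
Proof.
apply/asboolP; have [s ->] := tensor_sumP t.
exists [seq (S p.1, T p.2) | p <- s]; apply/funext => phi.
rewrite /tmap_fun tensor_sumE big_map.
by elim: s => [|p s IH]; rewrite ?big_nil// !big_cons IH.
Qed.

Definition tmap (t : tensor U V) : tensor U' V' := Tensor (tmap_subproof t).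

Lemma tmap_tens u v : tmap (tens u v) = tens (S u) (T v).
Proof. exact: tensor_eqP. Qed.

Lemma tmap_linear : linear tmap.
Proof. by move=> k x y; apply: tensor_eqP. Qed.

HB.instance Definition _ :=
  GRing.isLinear.Build K (tensor U V) (tensor U' V') _ tmap tmap_linear.

End TensorMap.

Section TensorProductAlgebra.
Variables (R : realType) (A B : cstarAlgType R).

Let tm_rl (phi : bilform A B) (a : A) (b : B) (d : B) :
  scalar (fun c : A => phi (cmul a c) (cmul b d)).
Proof. by move=> k x y; rewrite cmulDr cmulZr linearDl linearZl_LR. Qed.

Let tm_rr (phi : bilform A B) (a : A) (b : B) (c : A) :
  scalar (fun d : B => phi (cmul a c) (cmul b d)).
Proof. by move=> k x y; rewrite cmulDr cmulZr linearDr linearZr_LR. Qed.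

Let tm_form phi a b : bilform A B := mkbilform (tm_rl phi a b) (tm_rr phi a b).

Let tm_ll (t : tensor A B) (phi : bilform A B) (b : B) :
  scalar (fun a : A => t (tm_form phi a b) : R[i]).
Proof.
move=> k x y; have [s ->] := tensor_sumP t; rewrite !tensor_sumE/=.
rewrite mulr_sumr -big_split; apply: eq_bigr => p _ /=.
by rewrite cmulDl cmulZl linearDl linearZl_LR.
Qed.

Let tm_lr (t : tensor A B) (phi : bilform A B) (a : A) :
  scalar (fun b : B => t (tm_form phi a b) : R[i]).
Proof.
move=> k x y; have [s ->] := tensor_sumP t; rewrite !tensor_sumE/=.
rewrite mulr_sumr -big_split; apply: eq_bigr => p _ /=.
by rewrite cmulDl cmulZl linearDr linearZr_LR.
Qed.

(* (a (x) b) (c (x) d) = ac (x) bd, see tmul_tens. *)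
Definition tmul_fun (w z : tensor A B) : bilform A B -> R[i]^o :=
  fun phi => w (mkbilform (tm_ll z phi) (tm_lr z phi)).

Lemma tmul_sumE (s s' : seq (A * B)) phi :
  tmul_fun (tensor_sum s) (tensor_sum s') phi =
  \sum_(p <- s) \sum_(q <- s') phi (cmul p.1 q.1) (cmul p.2 q.2).
Proof.
by rewrite /tmul_fun tensor_sumE; apply: eq_bigr => p _ /=; rewrite tensor_sumE.
Qed.

Lemma tmul_subproof w z : tmul_fun w z \in (@tensor_pred _ A B).
Proof.
apply/asboolP; have [s ->] := tensor_sumP w; have [s' ->] := tensor_sumP z.
exists [seq (cmul p.1 q.1, cmul p.2 q.2) | p <- s, q <- s'].
apply/funext => phi; rewrite tmul_sumE big_allpairs_dep/=.
have sE (I : Type) (r : seq I) (F : I -> bilform A B -> R[i]^o) :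
    (\sum_(i <- r) F i) phi = \sum_(i <- r) F i phi.
  by elim: r => [|i r IH]; rewrite ?big_nil// !big_cons -IH.
by rewrite sE; apply: eq_bigr => p _; rewrite sE.
Qed.

Definition tmul (w z : tensor A B) : tensor A B := Tensor (tmul_subproof w z).

Lemma tmul_tens a b c d :
  tmul (tens a b) (tens c d) = tens (cmul a c) (cmul b d).
Proof. exact: tensor_eqP. Qed.

Lemma tmulDl x y z : tmul (x + y) z = tmul x z + tmul y z.
Proof. exact: tensor_eqP. Qed.

Lemma tmulDr x y z : tmul x (y + z) = tmul x y + tmul x z.
Proof.
apply: tensor_eqP => phi; have [s ->] := tensor_sumP x.
have [s1 ->] := tensor_sumP y; have [s2 ->] := tensor_sumP z.
have -> : tensor_sum s1 + tensor_sum s2 = tensor_sum (s1 ++ s2).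
  by rewrite /tensor_sum big_cat.
rewrite -[LHS]/(tmul_fun _ _ _) tmul_sumE.
rewrite -[RHS]/(tmul_fun _ _ phi + tmul_fun _ _ phi) !tmul_sumE.
by rewrite -big_split; apply: eq_bigr => p _; rewrite big_cat.
Qed.

Let fp_l (f : {scalar A}) (g : {scalar B}) b : scalar (fun a => f a * g b).
Proof. by move=> k x y; rewrite linearP mulrDl mulrA. Qed.

Let fp_r (f : {scalar A}) (g : {scalar B}) a : scalar (fun b => f a * g b).
Proof. by move=> k x y; rewrite linearP mulrDr mulrCA. Qed.

Definition functional_prod (f : {scalar A}) (g : {scalar B}) : bilform A B :=
  mkbilform (fp_l f g) (fp_r f g).

Definition injective_norm (t : tensor A B) : R :=
  sup [set r | exists (f : {scalar A}) (g : {scalar B}),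
    [/\ forall a, `|f a| <= `|a|, forall b, `|g b| <= `|b|
      & r = complex.Re `|t (functional_prod f g) : R[i]|]].

Definition projective_norm (t : tensor A B) : R :=
  inf [set \sum_(p <- s) rnorm p.1 * rnorm p.2 | s in [set s | t = tensor_sum s]].

End TensorProductAlgebra.

(* A norm on the algebraic tensor product of each pair of C*-algebras. *)
Record normfamily (R : realType) := Normfamily {
  tnorm :> forall A B : cstarAlgType R, tensor A B -> R;
  tnormD : forall (A B : cstarAlgType R) (x y : tensor A B),
    tnorm (x + y) <= tnorm x + tnorm y;
  tnormZ : forall (A B : cstarAlgType R) (k : R[i]) (x : tensor A B),
    tnorm (k *: x) = complex.Re `|k| * tnorm x;
  tnorm_eq0 : forall (A B : cstarAlgType R) (x : tensor A B),
    tnorm x = 0 -> x = 0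
}.

(* The algebraic tensor product, normed by alpha. *)
Definition ntensor (R : realType) (alpha : normfamily R) (A B : cstarAlgType R) : Type :=
  tensor A B.

HB.instance Definition _ R alpha A B := GRing.Lmodule.on (@ntensor R alpha A B).

Section NormedTensor.
Variables (R : realType) (alpha : normfamily R) (A B : cstarAlgType R).
Let N (t : ntensor alpha A B) : R[i] := real_complex R (alpha A B t).
Let ND x y : N (x + y) <= N x + N y.
Proof. by rewrite /N -rmorphD lecR; apply: tnormD. Qed.
Let NZ (k : R[i]) x : N (k *: x) = `|k| * N x.
Proof.
have kE : `|k| = real_complex R (complex.Re `|k|) by rewrite RRe_real ?normr_real.
rewrite /N [in RHS]kE -rmorphM; congr (real_complex R _); exact: tnormZ.
Qed.
Let N0 x : N x = 0 -> x = 0.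
Proof. by move=> /(@complexI R); apply: tnorm_eq0. Qed.
HB.instance Definition _ := Lmodule_isNormed.Build R[i] (ntensor alpha A B) ND NZ N0.
End NormedTensor.

Definition ctensor (R : realType) (alpha : normfamily R) (A B : cstarAlgType R) :
  completeNormedModType R[i] := completion (ntensor alpha A B).

Section CompletelyPositive.
Variables (R : realType) (A : cstarAlgType R) (n : nat).

Definition cmxmul (X Y : 'M[A]_n) : 'M[A]_n :=
  \matrix_(i, j) \sum_k cmul (X i k) (Y k j).

Definition cmxstar (X : 'M[A]_n) : 'M[A]_n := \matrix_(i, j) cstar (X j i).

(* Positivity in the C*-algebra M_n(A), where an element is positive iff it is
   of the form Y^* Y. *)
Definition mxpositive (X : 'M[A]_n) : Prop :=
  exists Y : 'M[A]_n, X = cmxmul (cmxstar Y) Y.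

End CompletelyPositive.

Definition completely_positive (R : realType) (A B : cstarAlgType R)
    (T : {linear A -> B}) : Prop :=
  forall (n : nat) (X : 'M[A]_n), mxpositive X -> mxpositive (map_mx T X).

Section TensorNorms.
Variables (R : realType) (alpha : normfamily R).

Definition is_tensor_norm : Prop :=
  forall (A B : cstarAlgType R) (t : tensor A B),
    injective_norm t <= alpha A B t <= projective_norm t.

Definition is_algebra_norm : Prop :=
  forall (A B : cstarAlgType R) (w z : tensor A B),
    alpha A B (tmul w z) <= alpha A B w * alpha A B z.

Definition cp_uniform : Prop :=
  forall (A1 B1 A2 B2 : cstarAlgType R)
    (T1 : {linear A1 -> B1}) (T2 : {linear A2 -> B2}),
    completely_positive T1 -> completely_positive T2 ->
  exists F : {linear ctensor alpha A1 A2 -> ctensor alpha B1 B2},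
    [/\ continuous F,
        forall t : ntensor alpha A1 A2,
          F (compl_embed t) = compl_embed (tmap T1 T2 t : ntensor alpha B1 B2)
      & opnorm F <= opnorm T1 * opnorm T2].

Variables A B : cstarAlgType R.

Definition ctensor_mul : ctensor alpha A B -> ctensor alpha A B -> ctensor alpha A B :=
  compl_mul (fun w z : ntensor alpha A B => tmul w z : ntensor alpha A B).

Lemma ctensor_mulP (x y : ctensor alpha A B) (u v : nat -> ntensor alpha A B) :
  is_algebra_norm ->
  (fun n => compl_embed (u n)) @ \oo --> x ->
  (fun n => compl_embed (v n)) @ \oo --> y ->
  (fun n => compl_embed (tmul (u n) (v n) : ntensor alpha A B)) @ \oo
    --> ctensor_mul x y.
Proof.
move=> algn; apply: compl_mulP => [|| w z]; [exact: tmulDl|exact: tmulDr|].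
exact: algn.
Qed.

Lemma ctensor_mul_embed (w z : ntensor alpha A B) : is_algebra_norm ->
  ctensor_mul (compl_embed w) (compl_embed z) =
  compl_embed (tmul w z : ntensor alpha A B).
Proof.
move=> algn; apply: compl_mul_embed => [|| ? ?]; [exact: tmulDl|exact: tmulDr|].
exact: algn.
Qed.

(* The image of the algebraic tensor product of I and B in the completion. *)
Definition tensor_subspace (I : set A) : set (ctensor alpha A B) :=
  [set compl_embed (tensor_sum s : ntensor alpha A B) | s in
     [set s : seq (A * B) | forall p, p \in s -> I p.1]].

End TensorNorms.

Section Ideals.
Variables (K : fieldType) (E : lmodType K) (mul : E -> E -> E) (L : set E).

Definition is_subspace : Prop :=
  L 0 /\ forall (k : K) x y, L x -> L y -> L (k *: x + y).

Definition lie_ideal : Prop :=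
  is_subspace /\ forall c x, L x -> L (mul c x - mul x c).

Definition is_ideal : Prop :=
  is_subspace /\ forall c x, L x -> L (mul c x) /\ L (mul x c).

End Ideals.

Definition is_unital (R : realType) (A : cstarAlgType R) : Prop :=
  exists e : A, forall a, cmul e a = a /\ cmul a e = a.

Definition separable (T : topologicalType) : Prop :=
  exists D : set T, countable D /\ dense D.

Definition infinite_dimensional (K : fieldType) (V : lmodType K) : Prop :=
  ~ exists (n : nat) (e : 'I_n -> V),
      forall x, exists c : 'I_n -> K, x = \sum_i c i *: e i.

(* Main.v *)
(* A Lie ideal L is stable under off-diagonal Peirce corners: for orthogonal
   projections p, q the double commutator with p and q isolates p x q up to
   q x p, and a further commutator with p separates the two.  With rank-one
   projections the corner p x q is a ⊗ theta u v, with theta u v the operator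
   sending h to <h, v> u; the coefficient a exists because the norm of A is
   recovered from the injective tensor norm (Hahn-Banach), so that A ⊗ theta u v
   is complete.  Let I be the set of all a with a ⊗ K(H) inside L.
   Commutators with c ⊗ theta move a ⊗ theta u v to every other off-diagonal
   matrix unit, with a multiplied by c on either side; diagonal units follow by
   averaging a ⊗ (theta u u - theta f f) over many orthonormal f, which uses that
   H is infinite-dimensional.  Hence I is an ideal containing every coefficient
   of an off-diagonal corner of an element x of L.  The diagonal coefficients lie
   in I as well: differences of two of them do, and they tend to 0 because K(H)
   consists of compact operators.  As x is approximated by finite sums of its
   corners, L is the closure of I ⊗ K(H). *)

Require Import Defs.
From HB Require Import structures.
From mathcomp Require Import all_boot all_order all_algebra.
From mathcomp Require Import complex.
From mathcomp Require Import boolp classical_sets functions cardinality reals.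
From mathcomp Require Import topology normedtype.
From mathcomp Require Import ring lra.
Set Implicit Arguments.
Unset Strict Implicit.
Unset Printing Implicit Defensive.
Import Order.TTheory GRing.Theory Num.Theory.
Import numFieldNormedType.Exports.
Local Open Scope classical_set_scope.
Local Open Scope ring_scope.

(** * Hahn-Banach extension *)

Section ComplexScalars.
Variable R : realType.

Lemma Re_norm_real (t : R) : 0 <= t -> complex.Re `|real_complex R t| = t.
Proof. by move=> t0; rewrite ger0_norm// ler0c. Qed.

Lemma Re_norm_ge0 (k : R[i]) : 0 <= complex.Re `|k|.
Proof. exact: (@rnorm_ge0 R R[i]^o k). Qed.

Lemma Re_normE (k : R[i]) : `|k| = real_complex R (complex.Re `|k|).
Proof. by rewrite RRe_real ?normr_real. Qed.

Lemma Re_normM (k l : R[i]) :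
  complex.Re `|k * l| = complex.Re `|k| * complex.Re `|l|.
Proof. exact: (@rnormZ R R[i]^o k l). Qed.

Lemma Re_norm_ge_Re (k : R[i]) : complex.Re k <= complex.Re `|k|.
Proof.
rewrite normc_def/= (le_trans (ler_norm _))// -sqrtr_sqr ler_wsqrtr//.
by rewrite lerDl sqr_ge0.
Qed.

End ComplexScalars.

Section HahnBanach.
Variables (R : realType) (V : normedModType R[i]).
Implicit Types (p q : V -> R) (x y : V).
Local Notation "t %:C" := (real_complex R t).

Definition sublinear p :=
  (forall x y, p (x + y) <= p x + p y) /\
  (forall t x, 0 < t -> p (t%:C *: x) = t * p x).

Lemma sublinear0 p : sublinear p -> p 0 = 0.
Proof.
move=> [_ pZ]; have := @pZ 2 0; rewrite scaler0 => /(_ ltac:(lra)); lra.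
Qed.

Lemma sublinear_ge p x : sublinear p -> - p (- x) <= p x.
Proof.
move=> sp; have := sp.1 x (- x); rewrite subrr (sublinear0 sp); lra.
Qed.

(* A minimal sublinear functional is invariant under this operation, which
   forces it to be additive. *)
Definition tilt q y x : R :=
  inf [set q (x + t%:C *: y) - t * q y | t in [set t : R | 0 <= t]].

Section Tilt.
Variables (q : V -> R) (y : V).
Hypothesis sq : sublinear q.

Let qZ t x : 0 <= t -> q (t%:C *: x) = t * q x.
Proof.
rewrite le_eqVlt => /predU1P[<-|]; last exact: sq.2.
by rewrite rmorph0 scale0r mul0r sublinear0.
Qed.

(** Subadditivity bounds [t * q y] by [q (x + t%:C *: y) + q (- x)], so the infimum defining [tilt]
    is finite. *)
Lemma tilt_lb x :
  lbound [set q (x + t%:C *: y) - t * q y | t in [set t : R | 0 <= t]] (- q (- x)).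
Proof.
move=> _ [t t0 <-]; rewrite -qZ//.
have := sq.1 (x + t%:C *: y) (- x); rewrite addrAC subrr add0r; lra.
Qed.

Lemma tilt_le x t : 0 <= t -> tilt q y x <= q (x + t%:C *: y) - t * q y.
Proof.
by move=> t0; apply: ge_inf; [exists (- q (- x)); exact: tilt_lb|exists t].
Qed.

Lemma le_tilt x m : (forall t, 0 <= t -> m <= q (x + t%:C *: y) - t * q y) ->
  m <= tilt q y x.
Proof.
move=> h; apply: lb_le_inf; first by exists (q (x + 0%:C *: y) - 0 * q y), 0 => /=.
by move=> _ [t t0 <-]; apply: h.
Qed.

Lemma tilt_id x : tilt q y x <= q x.
Proof.
by have := tilt_le x (lexx 0); rewrite rmorph0 scale0r addr0 mul0r subr0.
Qed.

(** The parameter [t = 1] moves [- y] to the origin. For a [q] equal to its own tilt, this is the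
    inequality that makes it odd at [y]. *)
Lemma tilt_opp : tilt q y (- y) <= - q y.
Proof.
have := tilt_le (- y) ler01; rewrite rmorph1 scale1r addNr (sublinear0 sq) mul1r.
lra.
Qed.

Lemma tilt_sublinear : sublinear (tilt q y).
Proof.
have sub x x' : tilt q y (x + x') <= tilt q y x + tilt q y x'.
  rewrite -lerBlDl; apply: le_tilt => t t0; rewrite lerBlDl -lerBlDr.
  apply: le_tilt => s s0; rewrite lerBlDr.
  (* If [s] is the parameter for [x] and [t] the one for [x'], then [s + t] serves the sum. *)
  have := tilt_le (x + x') (addr_ge0 s0 t0).
  have := sq.1 (x + s%:C *: y) (x' + t%:C *: y).
  rewrite addrACA -scalerDl -rmorphD mulrDl; lra.
have half t x : 0 < t -> tilt q y (t%:C *: x) <= t * tilt q y x.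
  move=> t0; rewrite mulrC -ler_pdivrMr//; apply: le_tilt => s s0.
  rewrite ler_pdivrMr//.
  have := tilt_le (t%:C *: x) (mulr_ge0 (ltW t0) s0).
  rewrite rmorphM -scalerA -scalerDr qZ ?(ltW t0)//; lra.
split=> // t x t0; apply/eqP; rewrite eq_le half//=.
(* The reverse inequality is [half] for the scalar [t^-1] at the point [t%:C *: x]. *)
have t0' : 0 < t^-1 by rewrite invr_gt0.
have := half _ (t%:C *: x) t0'; rewrite scalerA -rmorphM mulVf ?gt_eqF//.
by rewrite rmorph1 scale1r mulrC ler_pdivlMr// mulrC.
Qed.

End Tilt.

(** In a chain the smaller of [q] and [q'] can replace both, which gives subadditivity of the
    infimum; the lower bound [- p (- x)] keeps it finite. *)
Lemma chain_inf_sublinear (A : set (V -> R)) p : A !=set0 ->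
  (forall q, A q -> sublinear q /\ forall x, q x <= p x) ->
  (forall q q', A q -> A q' ->
    (forall x, q x <= q' x) \/ (forall x, q' x <= q x)) ->
  sublinear (fun x => inf [set q x | q in A]) /\
  forall q, A q -> forall x, inf [set q' x | q' in A] <= q x.
Proof.
move=> [q0 Aq0] As Atot.
have lb x : has_lbound [set q x | q in A].
  exists (- p (- x)) => _ [q /As[sq qp] <-].
  by rewrite (le_trans _ (sublinear_ge x sq))// lerN2.
have ile q : A q -> forall x, inf [set q' x | q' in A] <= q x.
  by move=> Aq x; apply: ge_inf => //; exists q.
have lei x m : (forall q, A q -> m <= q x) -> m <= inf [set q x | q in A].
  by move=> h; apply: lb_le_inf; [exists (q0 x), q0|move=> _ [q /h ? <-]].
split=> //.
have half t x : 0 < t ->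
    inf [set q (t%:C *: x) | q in A] <= t * inf [set q x | q in A].
  move=> t0; rewrite mulrC -ler_pdivrMr//; apply: lei => q Aq.
  by rewrite ler_pdivrMr// mulrC -(As _ Aq).1.2// ile.
split=> [x y|t x t0].
  rewrite -lerBlDl; apply: (lei) => q Aq; rewrite lerBlDl -lerBlDr.
  apply: lei => q' Aq'; rewrite lerBlDr.
  have [h|h] := Atot _ _ Aq Aq'.
    by rewrite (le_trans (ile _ Aq _))// (le_trans ((As _ Aq).1.1 _ _))// lerD.
  by rewrite (le_trans (ile _ Aq' _))// (le_trans ((As _ Aq').1.1 _ _))// lerD.
apply/eqP; rewrite eq_le half//=.
have t0' : 0 < t^-1 by rewrite invr_gt0.
have := half _ (t%:C *: x) t0'; rewrite scalerA -rmorphM mulVf ?gt_eqF//.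
by rewrite rmorph1 scale1r mulrC ler_pdivlMr// mulrC.
Qed.

Lemma sublinear_minimal p : sublinear p -> exists q,
  [/\ sublinear q, forall x, q x <= p x &
    forall q', sublinear q' -> (forall x, q' x <= q x) -> q' = q].
Proof.
move=> sp.
pose T := {q : V -> R | sublinear q /\ forall x, q x <= p x}.
(* The order is reversed, so that a maximal element in Zorn's lemma is a minimal functional. *)
pose r (q q' : T) := `[< forall x, sval q' x <= sval q x >].
have [||||q qmin] := @Zorn T r.
- by move=> q; apply/asboolP.
- move=> q1 q2 q3 /asboolP h /asboolP h'; apply/asboolP => x.
  by apply: le_trans (h x).
- move=> [q1 ?] [q2 ?] /asboolP/= h /asboolP/= h'; apply: eq_exist.
  apply/funext => x.
  by apply/eqP; rewrite eq_le h h'.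
- move=> A Atot.
  have [[q0 Aq0]|noA] := pselect (A !=set0); last first.
    exists (exist _ p (conj sp (fun x => lexx _))) => q Aq.
    by exfalso; apply: noA; exists q.
  pose B := [set sval q | q in A].
  have [|||sB Ble] := @chain_inf_sublinear B p.
  + by exists (sval q0), q0.
  + by move=> _ [q _ <-]; exact: (svalP q).
  + move=> _ _ [q Aq <-] [q' Aq' <-].
    by have [/asboolP|/asboolP] := Atot _ _ Aq Aq'; [right|left].
  + have Bp x : inf [set q x | q in B] <= p x.
      by rewrite (le_trans (Ble (sval q0) _ x))//; [exists q0|exact: (svalP q0).2].
    exists (exist _ (fun x => inf [set q x | q in B]) (conj sB Bp)) => q Aq.
    apply/asboolP => x /=.
    by apply: Ble; exists q.
- exists (sval q); have [sq qp] := svalP q; split=> // q' sq' q'q.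
  have q'p x : q' x <= p x by exact: le_trans (qp x).
  suff : exist _ q' (conj sq' q'p) = q by move=> <-.
  exact/qmin/asboolP.
Qed.

(** A minimal sublinear functional below [p] equals its tilt in every direction, hence is odd, and
    an odd sublinear functional is real linear. *)
Lemma hahn_banach_sublinear p : sublinear p -> exists f : V -> R,
  [/\ forall x y, f (x + y) = f x + f y,
      forall t x, f (t%:C *: x) = t * f x & forall x, f x <= p x].
Proof.
move=> /sublinear_minimal[q [sq qp qmin]].
have qN y : q (- y) = - q y.
  apply/eqP; rewrite eq_le; apply/andP; split.
    rewrite -{1}(qmin _ (tilt_sublinear y sq) (tilt_id y sq)).
    exact: tilt_opp.
  by have := sublinear_ge (- y) sq; rewrite opprK.
exists q; split=> // [x y|t x].
  apply/eqP; rewrite eq_le sq.1 andTb.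
  have := sq.1 (x + y) (- y); rewrite addrK qN; lra.
have [t0|t0|->] := ltgtP t 0; last by rewrite rmorph0 scale0r mul0r sublinear0.
  rewrite -[t]opprK rmorphN scaleNr qN sq.2 ?mulNr//.
  by rewrite oppr_gt0.
exact: sq.2.
Qed.

Lemma sublinear_rnorm : sublinear (@rnorm R V).
Proof.
split=> [x y|t x t0]; first exact: rnormD.
by rewrite rnormZ Re_norm_real// ltW.
Qed.

(** The norm is tilted at [a] before extending: a linear [g] below the tilt satisfies
    [g (- a) <= - rnorm a], so it norms [a]. *)
Lemma hahn_banach_norming (a : V) : exists f : {scalar V},
  (forall x, `|f x| <= `|x|) /\ rnorm a <= complex.Re `|f a|.
Proof.
have sN := sublinear_rnorm.
have [g [gD gZ gp]] := hahn_banach_sublinear (tilt_sublinear a sN).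
have gN x : g (- x) = - g x.
  by rewrite -[- x]scale1r scalerN -scaleNr -(rmorph1 (real_complex R)) -rmorphN
    gZ mulN1r.
have gle x : g x <= rnorm x := le_trans (gp x) (tilt_id a sN x).
have ga : rnorm a <= g a.
  by have := le_trans (gp (- a)) (tilt_opp a sN); rewrite gN lerN2.
pose i : R[i] := complex.Complex 0 1.
(* This is the complex-linear functional with real part [g]. *)
pose f x : R[i] := complex.Complex (g x) (- g (i *: x)).
have kE (k : R[i]) : k = (complex.Re k)%:C + i * (complex.Im k)%:C.
  case: k => u v; apply/eqP; rewrite eq_complex /i /=.
  by apply/andP; split; apply/eqP; ring.
have ii : i * i = - (1%:C).
  by apply/eqP; rewrite eq_complex /i /=; apply/andP; split; apply/eqP; ring.
have lf : scalar f.
  move=> k x y; rewrite [k]kE; move: (complex.Re k) (complex.Im k) => u v.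
  rewrite /f scalerDr !scalerA mulrDr !scalerDl !gD mulrA ii mulNr.
  rewrite -!rmorphM !mul1r (mulrC i (u%:C)) scaleNr gN (mulrC i (v%:C)).
  rewrite -!scalerA !gZ; apply/eqP; rewrite eq_complex/=.
  by apply/andP; split; apply/eqP; ring.
pose F : {scalar V} := HB.pack f (GRing.isLinear.Build _ _ _ _ f lf).
exists F; split=> [x|]; last first.
  by rewrite (le_trans ga)//; exact: (Re_norm_ge_Re (F a)).
rewrite rnormE Re_normE lecR.
have [->|fx0] := eqVneq (F x) 0; first by rewrite normr0 rnorm_ge0.
(* The unimodular factor [k] makes the value of [F] at [k *: x] nonnegative, hence equal to its real
   part, which [g] controls. *)
pose k := `|F x| / F x.
have k1 : complex.Re `|k| = 1.
  by rewrite /k normrM normr_id normfV mulfV ?normr_eq0.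
have -> : `|F x| = F (k *: x) by rewrite linearZ/= /k divfK.
rewrite -[leLHS]/(g (k *: x)) (le_trans (gle _))//.
by rewrite rnormZ k1 mul1r.
Qed.

End HahnBanach.

(** * Rank-one operators and finite-rank projections *)

Section RankOne.
Variables (R : realType) (H : hilbertType R).
Implicit Types (x y z u v w : H) (s : seq H) (k : compactop H).
Local Notation "t %:C" := (real_complex R t).

Lemma hdot_cauchy_schwarz x y : complex.Re `|hdot x y| <= rnorm x * rnorm y.
Proof.
have [->|h0] := eqVneq (hdot x y) 0.
  by rewrite normr0 mulr_ge0 ?rnorm_ge0.
pose k := `|hdot x y| / hdot x y.
have k1 : complex.Re `|k| = 1.
  by rewrite /k normrM normr_id normfV mulfV ?normr_eq0.
have -> : `|hdot x y| = hdot (k *: x) y by rewrite hdotZl /k divfK.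
by rewrite (le_trans (rdot_le _ _))// rnormZ k1 mul1r.
Qed.

Lemma hdot0r x : hdot x 0 = 0.
Proof. by rewrite linear0r. Qed.

Lemma hdotBl x y z : hdot (x - y) z = hdot x z - hdot y z.
Proof. by rewrite linearBl. Qed.

Lemma hdot_eq0C x y : hdot x y = 0 -> hdot y x = 0.
Proof. by move=> h; rewrite hdotC h rmorph0. Qed.

Lemma hdot_unit u : rnorm u = 1 -> hdot u u = 1.
Proof. by move=> u1; rewrite hdot_norm rnormE u1 expr1n. Qed.

Lemma totbounded_real_line (T : Type) (D : set T) (f : T -> R) (M : R) w :
  (forall t, D t -> `|f t| <= M) -> totbounded ((fun t => (f t)%:C *: w) @` D).
Proof.
move=> fM e e0.
have w1 : 0 < rnorm w + 1 by rewrite ltr_wpDl ?rnorm_ge0.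
pose d := e / (rnorm w + 1); have d0 : 0 < d by rewrite divr_gt0.
(* A grid of step [d] starting at [- M]: the index of [f x] is the integer part of [(f x + M) / d],
   which is at most [2 * M / d]. *)
pose N := (Num.truncn (2 * M / d)).+1.
exists [seq (d * n%:R - M)%:C *: w | n <- iota 0 N] => _ [x Dx <-].
have := fM x Dx; rewrite ler_norml => /andP[f1 f2].
have q0 : 0 <= (f x + M) / d by rewrite divr_ge0 ?(ltW d0)//; lra.
pose n := Num.truncn ((f x + M) / d).
have /andP[n1 n2] := truncn_itv q0.
exists ((d * n%:R - M)%:C *: w).
  apply/mapP; exists n => //; rewrite mem_iota add0n ltnS /n le_truncn//.
  by rewrite ler_pM2r ?invr_gt0//; lra.
rewrite -scalerBl -rmorphB rnormZ Re_norm_real; last first.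
  by move: n1; rewrite ler_pdivlMr// -/n; lra.
have : f x - (d * n%:R - M) < d.
  by move: n2; rewrite ltr_pdivrMr// -/n -[n.+1]addn1 natrD; lra.
move=> /ltW h; rewrite (le_lt_trans (ler_wpM2r (rnorm_ge0 w) h))//.
by rewrite /d mulrAC ltr_pdivrMr// ltr_pM2l// ltrDl.
Qed.

(** The real and imaginary parts of [hdot x v] are real inner products with [v] and [i v]; each
    contributes a bounded piece of a real line. *)
Lemma rank_one_compact u v : compact_operator (fun x => hdot x v *: u).
Proof.
apply/compactP; split.
  by move=> k x y; rewrite hdotDl hdotZl scalerDl scalerA.
have -> : (fun x => hdot x v *: u) = (fun x => (rdot x v)%:C *: u
    + (rdot x (complex.Complex 0 1 *: v))%:C *: (complex.Complex 0 1 *: u)).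
  apply/funext => x; rewrite scalerA -scalerDl; congr (_ *: _).
  rewrite /rdot linearZr_LR/=.
  by case: (hdot x v) => a b; apply/eqP; rewrite eq_complex/=;
    apply/andP; split; apply/eqP; ring.
apply: totboundedD.
  apply: (@totbounded_real_line _ _ _ (rnorm v)) => x; rewrite /= unit_ballE => x1.
  by rewrite (le_trans (rdot_abs _ _))// ler_piMl ?rnorm_ge0.
apply: (@totbounded_real_line _ _ _ (rnorm (complex.Complex 0 1 *: v))) => x.
rewrite /= unit_ballE => x1.
by rewrite (le_trans (rdot_abs _ _))// ler_piMl ?rnorm_ge0.
Qed.

Definition theta u v : compactop H :=
  Compactop (introT (asboolP _) (rank_one_compact u v)).

Lemma thetaE u v x : theta u v x = hdot x v *: u.
Proof. by []. Qed.

Lemma theta_rnorm u v : rnorm (theta u v) <= rnorm u * rnorm v.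
Proof.
rewrite compactop_rnorm; apply: compactop_normle.
  by rewrite mulr_ge0 ?rnorm_ge0.
move=> x; rewrite thetaE rnormZ mulrC -mulrA ler_wpM2l ?rnorm_ge0//.
by rewrite mulrC; exact: hdot_cauchy_schwarz.
Qed.

Lemma kmulE (k l : compactop H) x : cmul k l x = k (l x).
Proof. by []. Qed.

Lemma kmul_theta k u v : cmul k (theta u v) = theta (k u) v.
Proof.
apply: compactop_ext => x.
by rewrite kmulE !thetaE (linfZ (compactop_linear k)).
Qed.

Lemma thetaM u v w z : cmul (theta u v) (theta w z) = hdot w v *: theta u z.
Proof.
rewrite kmul_theta; apply: compactop_ext => x.
by rewrite compactop_scaleE !thetaE !scalerA mulrC.
Qed.

Lemma theta_sandwich k u v :
  cmul (cmul (theta u u) k) (theta v v) = hdot (k v) u *: theta u v.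
Proof. by rewrite -cmulA kmul_theta thetaM. Qed.

Lemma cstar_theta u v : cstar (theta u v) = theta v u.
Proof.
apply: compactop_ext => y.
apply: (adjoint_uniq (compactop_linear _) (@compactop_bddby _ _ _)) => x.
by rewrite !thetaE hdotZl linearZr_LR/= -hdotC mulrC.
Qed.

(** * Orthonormal families and Gram-Schmidt *)

Fixpoint orthonormal_seq s : Prop :=
  if s is u :: s' then
    [/\ rnorm u = 1, forall v, v \in s' -> hdot u v = 0 & orthonormal_seq s']
  else True.

Lemma orthonormal_unit s u : orthonormal_seq s -> u \in s -> rnorm u = 1.
Proof.
elim: s => // v s IH [v1 _ os]; rewrite inE => /predU1P[->//|]; exact: IH.
Qed.

Lemma orthonormal_ortho s u v : orthonormal_seq s -> u \in s -> v \in s ->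
  u = v \/ hdot u v = 0.
Proof.
elim: s => // w s IH [w1 ws os]; rewrite !inE.
move=> /predU1P[->|us] /predU1P[->|vs]; [by left|right|right|exact: IH].
  exact: ws.
exact/hdot_eq0C/ws.
Qed.

(** For an orthonormal [s] this is the orthogonal projection onto the span of [s]. *)
Definition proj s : compactop H := \sum_(u <- s) theta u u.

Lemma proj_cons u s x : proj (u :: s) x = hdot x u *: u + proj s x.
Proof. by rewrite /proj big_cons. Qed.

Lemma projE s x : proj s x = \sum_(u <- s) hdot x u *: u.
Proof.
by elim: s => [|u s IH]; rewrite ?proj_cons ?IH ?big_cons// /proj !big_nil.
Qed.

Lemma hdot_proj0 s x z : (forall v, v \in s -> hdot z v = 0) ->
  hdot z (proj s x) = 0.
Proof.
elim: s => [|u s IH] h; first by rewrite /proj big_nil; exact: hdot0r.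
rewrite proj_cons linearDr linearZr_LR/= h ?mem_head// mulr0 add0r.
by apply: IH => v vs; rewrite h// inE vs orbT.
Qed.

Lemma hdot_proj s x v : orthonormal_seq s -> v \in s ->
  hdot (proj s x) v = hdot x v.
Proof.
elim: s => // u s IH [u1 us os]; rewrite inE proj_cons hdotDl hdotZl.
move=> /predU1P[->|vs]; last by rewrite us// mulr0 add0r IH.
rewrite hdot_unit// mulr1 [hdot (proj s x) u]hdot_eq0C ?addr0//.
exact: hdot_proj0.
Qed.

Lemma proj_residual s x v : orthonormal_seq s -> v \in s ->
  hdot (x - proj s x) v = 0.
Proof. by move=> os vs; rewrite hdotBl hdot_proj// subrr. Qed.

(** Bessel's inequality: the residual [x - proj s x] is orthogonal to [proj s x], so Pythagoras
    applies. *)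
Lemma proj_contract s x : orthonormal_seq s -> rnorm (proj s x) <= rnorm x.
Proof.
move=> os; rewrite -(@ler_pXn2r _ 2) ?nnegrE ?rnorm_ge0//.
have := rnorm_sqD (x - proj s x) (proj s x); rewrite subrK => ->.
rewrite {1}/rdot hdot_proj0 ?mulr0 ?addr0 ?lerDr ?sqr_ge0// => v vs.
exact: proj_residual.
Qed.

Lemma proj_rnorm s : orthonormal_seq s -> rnorm (proj s) <= 1.
Proof.
move=> os; rewrite compactop_rnorm; apply: compactop_normle => // x.
by rewrite mul1r proj_contract.
Qed.

Lemma normalize z : z != 0 -> exists2 t : R, 0 < t & exists2 w,
  rnorm w = 1 & z = t%:C *: w.
Proof.
move=> z0; have t0 : 0 < rnorm z.
  by rewrite lt0r rnorm_ge0 andbT; apply: contra_neq z0; exact: rnorm_eq0.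
exists (rnorm z) => //; exists ((rnorm z)^-1%:C *: z).
  by rewrite rnormZ Re_norm_real ?invr_ge0 ?rnorm_ge0// mulVf ?gt_eqF.
by rewrite scalerA -rmorphM mulfV ?gt_eqF// rmorph1 scale1r.
Qed.

Lemma real_complex_neq0 (t : R) : 0 < t -> t%:C != 0.
Proof.
by move=> t0; rewrite -(rmorph0 (real_complex R)) (inj_eq (@complexI R)) gt_eqF.
Qed.

(** Membership in the span is expressed as being fixed by [proj s]. A vector already fixed adds
    nothing; otherwise its normalized residual joins the family. *)
Lemma gram_schmidt (ys : seq H) :
  exists2 s, orthonormal_seq s & forall y, y \in ys -> proj s y = y.
Proof.
elim: ys => [|y ys [s os sP]]; first by exists [::].
have [yE|y0] := eqVneq (y - proj s y) 0.
  exists s => // z; rewrite inE => /predU1P[->|/sP//].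
  by apply/esym/eqP; rewrite -subr_eq0 yE.
have [t t0 [w w1 yE]] := normalize y0.
have ws v : v \in s -> hdot w v = 0.
  move=> vs; have := proj_residual y os vs; rewrite yE hdotZl => /eqP.
  by rewrite mulf_eq0 (negPf (real_complex_neq0 t0)) => /eqP.
have ps z : hdot (proj s z) w = 0 by apply/hdot_eq0C/hdot_proj0.
exists (w :: s) => // z; rewrite inE proj_cons => /predU1P[->|zs].
  have {1}-> : y = t%:C *: w + proj s y by rewrite -yE subrK.
  by rewrite hdotDl ps hdotZl hdot_unit// addr0 mulr1 -yE subrK.
by rewrite sP// -{1}(sP _ zs) ps scale0r add0r.
Qed.

Lemma exists_unit_orthogonal (ys : seq H) : infinite_dimensional H ->
  exists2 w, rnorm w = 1 & forall y, y \in ys -> hdot y w = 0.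
Proof.
move=> infH; have [s os sP] := gram_schmidt ys.
have [[z z0]|n] := pselect (exists z, z - proj s z != 0).
  have [t t0 [w w1 zE]] := normalize z0; exists w => // y /sP <-.
  apply/hdot_eq0C/hdot_proj0 => v vs.
  have := proj_residual z os vs; rewrite zE hdotZl => /eqP.
  by rewrite mulf_eq0 (negPf (real_complex_neq0 t0)) => /eqP.
(* If [proj s] fixed every vector, the finite family [s] would span [H]. *)
exfalso; apply: infH; exists (size s), (fun i => s`_i) => x.
exists (fun i => hdot x s`_i).
rewrite -(big_mkord xpredT (fun i => hdot x s`_i *: s`_i)).
rewrite -(big_nth 0 xpredT (fun u => hdot x u *: u)) -projE.
apply/eqP; rewrite -subr_eq0; apply: contra_notT n => h; by exists x.
Qed.

Lemma exists_orthonormal (ys : seq H) n : infinite_dimensional H ->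
  exists s, [/\ size s = n, orthonormal_seq s
    & forall u y, u \in s -> y \in ys -> hdot y u = 0].
Proof.
move=> infH; elim: n => [|n [s [sn os sP]]]; first by exists [::].
have [w w1 wP] := exists_unit_orthogonal (s ++ ys) infH.
exists (w :: s); split; rewrite /= ?sn//.
  by split=> // v vs; apply/hdot_eq0C/wP; rewrite mem_cat vs.
move=> u y; rewrite inE => /predU1P[->|us] yys; last exact: sP.
by apply: wP; rewrite mem_cat yys orbT.
Qed.

(** * Approximation of compact operators by finite-rank projections *)

Lemma rnorm_cstar (B : cstarAlgType R) (b : B) : rnorm (cstar b) = rnorm b.
Proof.
suff h (c : B) : rnorm c <= rnorm (cstar c).
  by apply/eqP; rewrite eq_le h andbT -{2}[b]cstarK h.
have [->|c0] := eqVneq (rnorm c) 0; first exact: rnorm_ge0.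
have cp : 0 < rnorm c by rewrite lt0r c0 rnorm_ge0.
have := cnormM (cstar c) c; rewrite cstar_norm !rnormE -rmorphM -rmorphXn lecR.
by rewrite expr2 ler_pM2r.
Qed.

Lemma cstar_proj s : cstar (proj s) = proj s.
Proof.
have s0 : cstar (0 : compactop H) = 0.
  by rewrite -(scale0r 0) cstarZ rmorph0 !scale0r.
elim: s => [|u s IH]; first by rewrite /proj big_nil.
by rewrite /proj big_cons cstarD cstar_theta -/(proj s) IH.
Qed.

(** The list [ys] is an [e / 2]-net of the image of the unit ball; a projection fixing the net moves
    that image by at most [e]. Since every such [s] works, several approximations are met at once by
    concatenating lists. *)
Lemma proj_approxl k (e : R) : 0 < e ->
  exists ys : seq H, forall s, orthonormal_seq s ->
  (forall y, y \in ys -> proj s y = y) -> rnorm (k - cmul (proj s) k) <= e.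
Proof.
move=> e0; have e2 : 0 < e / 2 by lra.
have [_ /(_ _ e2)[ys ysP]] := (compactP k).1 (compactop_spec k).
exists ys => s os sP; rewrite compactop_rnorm.
apply: opnorm_le; first exact: ltW.
apply: bddby_ball; first exact: (compactop_linear (k - cmul (proj s) k)).
move=> x x1; rewrite compactop_subE kmulE.
have [|c cs xc] := ysP (k x); first by exists x; rewrite //= unit_ballE.
have := rnorm_tri c (k x) (proj s (k x)).
rewrite -{2}(sP c cs) -(linfB (compactop_linear (proj s))).
have := proj_contract (c - k x) os; rewrite (rnormC c (k x)); lra.
Qed.

Lemma cstarB (B : cstarAlgType R) (b c : B) : cstar (b - c) = cstar b - cstar c.
Proof. by rewrite cstarD -scaleN1r cstarZ rmorphN rmorph1 scaleN1r. Qed.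

(** The right-hand estimate is the left-hand one for [cstar k], as the star is isometric and fixes
    [proj s]. *)
Lemma proj_approx k (e : R) : 0 < e ->
  exists ys : seq H, forall s, orthonormal_seq s ->
  (forall y, y \in ys -> proj s y = y) ->
  rnorm (k - cmul (proj s) k) <= e /\ rnorm (k - cmul k (proj s)) <= e.
Proof.
move=> e0; have [ys ysP] := proj_approxl k e0.
have [zs zsP] := proj_approxl (cstar k) e0.
exists (ys ++ zs) => s os sP; split.
  by apply: ysP => // y yys; apply: sP; rewrite mem_cat yys.
rewrite -rnorm_cstar cstarB cstarM cstar_proj; apply: zsP => // y yzs.
by apply: sP; rewrite mem_cat yzs orbT.
Qed.

End RankOne.

(** * Algebra in the completed tensor product *)

Section Closure.
Variables (R : realType) (V : normedModType R[i]).

Lemma closure_rnormP (S : set V) x :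
  closure S x <-> forall e : R, 0 < e -> exists2 y, S y & rnorm (x - y) < e.
Proof.
split=> [Sx e e0|h B /nbhs_ballP[_ /posCP[e e0 ->] eB]].
  have e0' : 0 < real_complex R e by rewrite ltcR.
  by have [y [Sy /rnorm_ball xy]] := Sx _ (nbhsx_ballx x _ e0'); exists y.
by have [y Sy xy] := h e e0; exists y; split => //; apply/eB/rnorm_ball.
Qed.

Lemma closed_rnorm (S : set V) x : closed S ->
  (forall e : R, 0 < e -> exists2 y, S y & rnorm (x - y) < e) -> S x.
Proof. by move=> cS h; apply/cS/closure_rnormP. Qed.

Lemma rnorm_close (z x y : V) (d : R) :
  rnorm (z - x) < d / 2 -> rnorm (z - y) < d / 2 -> rnorm (x - y) < d.
Proof. have := rnorm_tri z x y; rewrite (rnormC x z); lra. Qed.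

Lemma rnormDB (x x' y y' : V) :
  rnorm (x + y - (x' + y')) <= rnorm (x - x') + rnorm (y - y').
Proof. by rewrite opprD addrACA rnormD. Qed.

(** Meant for [z = P x] and [z' = P y] with [P] linear of norm at most [M]: if [P] almost fixes [y],
    it almost fixes every [x] near [y]. *)
Lemma rnorm_transfer (x y z z' : V) (M d : R) : rnorm (x - y) * (M + 1) < d ->
  rnorm (z - z') <= M * rnorm (x - y) -> rnorm (y - z') <= d ->
  rnorm (x - z) <= d + d.
Proof.
have := rnorm_tri y x z; have := rnorm_tri z' y z; rewrite (rnormC z' z); lra.
Qed.

End Closure.

Section AlgebraicTensor.
Variables (R : realType) (A B : cstarAlgType R).
Implicit Types (t x y z : tensor A B).

Lemma tensor_ind (P : tensor A B -> Prop) : P 0 ->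
  (forall a b t, P t -> P (tens a b + t)) -> forall t, P t.
Proof.
move=> P0 PS t; have [s ->] := tensor_sumP t.
by elim: s => [|p s IH]; rewrite /tensor_sum ?big_nil// big_cons; apply: PS.
Qed.

Lemma tensDl a a' b : tens (a + a') b = tens a b + tens a' b :> tensor A B.
Proof. by apply: tensor_eqP => phi; exact: linearDl. Qed.

Lemma tensDr a b b' : tens a (b + b') = tens a b + tens a b' :> tensor A B.
Proof. by apply: tensor_eqP => phi; exact: linearDr. Qed.

Lemma tensZl k a b : tens (k *: a) b = k *: tens a b :> tensor A B.
Proof. by apply: tensor_eqP => phi; exact: linearZl_LR. Qed.

Lemma tensZr k a b : tens a (k *: b) = k *: tens a b :> tensor A B.
Proof. by apply: tensor_eqP => phi; exact: linearZr_LR. Qed.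

Lemma tmul0l x : tmul 0 x = 0.
Proof. by apply: (@addrI _ (tmul 0 x)); rewrite -tmulDl !addr0. Qed.

Lemma tmul0r x : tmul x 0 = 0.
Proof. by apply: (@addrI _ (tmul x 0)); rewrite -tmulDr !addr0. Qed.

Lemma tmulZl k x y : tmul (k *: x) y = k *: tmul x y.
Proof. exact: tensor_eqP. Qed.

Lemma tmulZr k x y : tmul x (k *: y) = k *: tmul x y.
Proof.
elim/tensor_ind: x => [|a b x IH]; first by rewrite !tmul0l scaler0.
rewrite !tmulDl scalerDr {}IH; congr (_ + _).
elim/tensor_ind: y => [|c d y IH]; first by rewrite scaler0 tmul0r scaler0.
by rewrite scalerDr !tmulDr scalerDr {}IH -tensZl !tmul_tens cmulZr tensZl.
Qed.

Lemma tmulA x y z : tmul x (tmul y z) = tmul (tmul x y) z.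
Proof.
elim/tensor_ind: x => [|a b x IH]; first by rewrite !tmul0l.
rewrite !tmulDl {}IH; congr (_ + _).
elim/tensor_ind: y => [|c d y IH]; first by rewrite !(tmul0l, tmul0r).
rewrite !(tmulDl, tmulDr) {}IH; congr (_ + _).
elim/tensor_ind: z => [|f g z IH]; first by rewrite !tmul0r.
by rewrite !tmulDr {}IH !tmul_tens !cmulA.
Qed.

End AlgebraicTensor.

Section CompletedTensor.
Variables (R : realType) (alpha : normfamily R) (A B : cstarAlgType R).
Hypothesis algn : is_algebra_norm alpha.
Local Notation T := (ntensor alpha A B).
Local Notation C := (ctensor alpha A B).
Local Notation "x ** y" := (ctensor_mul x y) (at level 40, left associativity).
Implicit Types x y z : C.

Let mul_lim x y (u v : nat -> T) :
  rcvg (fun n => compl_embed (u n)) x -> rcvg (fun n => compl_embed (v n)) y ->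
  rcvg (fun n => compl_embed (tmul (u n) (v n) : T)) (x ** y).
Proof. by move=> /rcvgP ux /rcvgP vy; apply/rcvgP/ctensor_mulP. Qed.

(** By uniqueness of limits, the associative, distributive and scalar laws pass from the algebraic
    tensor product to its completion. *)
Let lim_eq x y (u v : nat -> T) : (forall n, u n = v n) ->
  rcvg (fun n => compl_embed (u n)) x -> rcvg (fun n => compl_embed (v n)) y ->
  x = y.
Proof.
by move=> uv ux; apply: rcvg_uniq; apply: rcvg_ext ux => n; rewrite uv.
Qed.

Let embD (u v : nat -> T) x y :
  rcvg (fun n => compl_embed (u n)) x -> rcvg (fun n => compl_embed (v n)) y ->
  rcvg (fun n => compl_embed (u n + v n)) (x + y).
Proof.
by move=> ux vy; apply: rcvg_ext (rcvgD ux vy) => n; rewrite linearD.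
Qed.

Let embZ k (u : nat -> T) x : rcvg (fun n => compl_embed (u n)) x ->
  rcvg (fun n => compl_embed (k *: u n)) (k *: x).
Proof. by move=> ux; apply: rcvg_ext (rcvgZ k ux) => n; rewrite linearZ. Qed.

Lemma ctensor_mulA x y z : x ** (y ** z) = x ** y ** z.
Proof.
have [u ux] := compl_embed_seq x; have [v vy] := compl_embed_seq y.
have [w wz] := compl_embed_seq z.
apply: lim_eq (mul_lim ux (mul_lim vy wz)) (mul_lim (mul_lim ux vy) wz) => n.
exact: tmulA.
Qed.

Lemma ctensor_mulDl x y z : (x + y) ** z = x ** z + y ** z.
Proof.
have [u ux] := compl_embed_seq x; have [v vy] := compl_embed_seq y.
have [w wz] := compl_embed_seq z.
apply: lim_eq (mul_lim (embD ux vy) wz) (embD (mul_lim ux wz) (mul_lim vy wz)) => n.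
exact: tmulDl.
Qed.

Lemma ctensor_mulDr x y z : x ** (y + z) = x ** y + x ** z.
Proof.
have [u ux] := compl_embed_seq x; have [v vy] := compl_embed_seq y.
have [w wz] := compl_embed_seq z.
apply: lim_eq (mul_lim ux (embD vy wz)) (embD (mul_lim ux vy) (mul_lim ux wz)) => n.
exact: tmulDr.
Qed.

Lemma ctensor_mulZl k x y : (k *: x) ** y = k *: (x ** y).
Proof.
have [u ux] := compl_embed_seq x; have [v vy] := compl_embed_seq y.
apply: lim_eq (mul_lim (embZ k ux) vy) (embZ k (mul_lim ux vy)) => n.
exact: tmulZl.
Qed.

Lemma ctensor_mulZr k x y : x ** (k *: y) = k *: (x ** y).
Proof.
have [u ux] := compl_embed_seq x; have [v vy] := compl_embed_seq y.
apply: lim_eq (mul_lim ux (embZ k vy)) (embZ k (mul_lim ux vy)) => n.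
exact: tmulZr.
Qed.

Lemma ctensor_mul0l x : 0 ** x = 0.
Proof. by rewrite -(scale0r 0) ctensor_mulZl !scale0r. Qed.

Lemma ctensor_mul0r x : x ** 0 = 0.
Proof. by rewrite -(scale0r 0) ctensor_mulZr !scale0r. Qed.

Lemma ctensor_mulBl x y z : (x - y) ** z = x ** z - y ** z.
Proof.
by rewrite ctensor_mulDl -(scaleN1r y) -(scaleN1r (y ** z)) ctensor_mulZl.
Qed.

Lemma ctensor_mulBr x y z : x ** (y - z) = x ** y - x ** z.
Proof.
by rewrite ctensor_mulDr -(scaleN1r z) -(scaleN1r (x ** z)) ctensor_mulZr.
Qed.

Lemma ctensor_mul_suml (I : Type) (s : seq I) (F : I -> C) x :
  (\sum_(i <- s) F i) ** x = \sum_(i <- s) F i ** x.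
Proof.
elim: s => [|i s IH]; first by rewrite !big_nil ctensor_mul0l.
by rewrite !big_cons ctensor_mulDl IH.
Qed.

Lemma ctensor_mul_sumr (I : Type) (s : seq I) (F : I -> C) x :
  x ** (\sum_(i <- s) F i) = \sum_(i <- s) x ** F i.
Proof.
elim: s => [|i s IH]; first by rewrite !big_nil ctensor_mul0r.
by rewrite !big_cons ctensor_mulDr IH.
Qed.

Lemma ctensor_mul_rnorm x y : rnorm (x ** y) <= rnorm x * rnorm y.
Proof.
apply/ler_addgt0Pr => e e0.
have [x0 y0] := (rnorm_ge0 x, rnorm_ge0 y).
have c0 : 0 < rnorm x + rnorm y + 1 by lra.
(* This [d] gives [(rnorm x + d) * (rnorm y + d) <= rnorm x * rnorm y + e]; the bound [d <= 1]
   absorbs the term [d ^+ 2]. *)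
pose d := Num.min 1 (e / (rnorm x + rnorm y + 1)).
have d0 : 0 < d by rewrite lt_min ltr01 divr_gt0.
have d1 : d <= 1 by rewrite ge_min lexx.
have de : d * (rnorm x + rnorm y + 1) <= e.
  by rewrite -ler_pdivlMr// ge_min lexx orbT.
have [u ux] := compl_embed_seq x; have [v vy] := compl_embed_seq y.
have bound (w : nat -> T) z : rcvg (fun n => compl_embed (w n)) z ->
    exists N, forall n, (N <= n)%N -> rnorm (w n) <= rnorm z + d.
  move=> /(_ _ d0)[N hN]; exists N => n /hN.
  have := rnorm_triB (compl_embed (w n)) z; rewrite compl_embed_rnorm; lra.
have [[N hN] [M hM]] := (bound _ _ ux, bound _ _ vy).
apply: (@le_trans _ _ ((rnorm x + d) * (rnorm y + d))); last by nra.
apply: rcvg_norm_le (mul_lim ux vy) _; exists (maxn N M) => n.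
rewrite geq_max => /andP[/hN h1 /hM h2]; rewrite compl_embed_rnorm.
apply: (le_trans (algn (u n) (v n))).
by apply: ler_pM h1 h2; exact: rnorm_ge0.
Qed.

(** * Elementary tensors and their norms *)

Definition pure (a : A) (b : B) : C := compl_embed (tens a b : T).

Lemma pureDl a a' b : pure (a + a') b = pure a b + pure a' b.
Proof. by rewrite /pure tensDl linearD. Qed.

Lemma pureDr a b b' : pure a (b + b') = pure a b + pure a b'.
Proof. by rewrite /pure tensDr linearD. Qed.

Lemma pureZl k a b : pure (k *: a) b = k *: pure a b.
Proof. by rewrite /pure tensZl linearZ. Qed.

Lemma pureZr k a b : pure a (k *: b) = k *: pure a b.
Proof. by rewrite /pure tensZr linearZ. Qed.

Lemma pure0r a : pure a 0 = 0.
Proof. by rewrite -(scale0r 0) pureZr scale0r. Qed.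

Lemma pureBl a a' b : pure (a - a') b = pure a b - pure a' b.
Proof. by rewrite pureDl -(scaleN1r a') -(scaleN1r (pure a' b)) pureZl. Qed.

Lemma pureBr a b b' : pure a (b - b') = pure a b - pure a b'.
Proof. by rewrite pureDr -(scaleN1r b') -(scaleN1r (pure a b')) pureZr. Qed.

Lemma pure0l b : pure 0 b = 0.
Proof. by rewrite -(scale0r 0) pureZl scale0r. Qed.

Lemma pure_sumr (I : Type) (s : seq I) a (F : I -> B) :
  pure a (\sum_(i <- s) F i) = \sum_(i <- s) pure a (F i).
Proof.
by elim: s => [|i s IH]; rewrite ?big_nil ?pure0r// !big_cons pureDr IH.
Qed.

Lemma pureM a b c d : pure a b ** pure c d = pure (cmul a c) (cmul b d).
Proof. by rewrite /pure ctensor_mul_embed// tmul_tens. Qed.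

Lemma compl_embed_tensor_sum (s : seq (A * B)) :
  compl_embed (tensor_sum s : T) = \sum_(p <- s) pure p.1 p.2.
Proof. by rewrite /tensor_sum linear_sum. Qed.

Lemma pure_sum_dense x (e : R) : 0 < e -> exists s : seq (A * B),
  rnorm (x - \sum_(p <- s) pure p.1 p.2) < e.
Proof.
move=> e0; have [u /(_ _ e0)[N /(_ _ (leqnn N))]] := compl_embed_seq x.
have [s ->] := tensor_sumP (u N).
by rewrite compl_embed_tensor_sum rnormC; exists s.
Qed.

Hypothesis tn : is_tensor_norm alpha.

Lemma pure_rnorm_le a b : rnorm (pure a b) <= rnorm a * rnorm b.
Proof.
rewrite compl_embed_rnorm.
have /andP[_ h] := tn (tens a b); apply: (le_trans h).
apply: ge_inf; last first.
  by exists [:: (a, b)]; rewrite /= ?big_seq1// /tensor_sum big_seq1.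
exists 0 => _ [s _ <-]; apply: sumr_ge0 => p _.
by rewrite mulr_ge0 ?rnorm_ge0.
Qed.

(** The injective norm, which [alpha] dominates, is tested on the product of [g] with a Hahn-Banach
    functional norming [a]. *)
Lemma le_pure_rnorm a b (g : {scalar B}) : (forall b', `|g b'| <= `|b'|) ->
  complex.Re `|g b| = 1 -> rnorm a <= rnorm (pure a b).
Proof.
move=> gle gb; have [f [fle fa]] := hahn_banach_norming a.
rewrite compl_embed_rnorm.
have /andP[h _] := tn (tens a b); apply: le_trans h.
apply: (@le_trans _ _ (complex.Re `|f a * g b|)).
  by rewrite Re_normM gb mulr1.
apply: ub_le_sup; last by exists f, g; split.
  exists (rnorm a * rnorm b) => _ [f' [g' [fle' gle' ->]]].
  rewrite -[X in `|X|]/(f' a * g' b) Re_normM.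
  have h1 := fle' a; have h2 := gle' b.
  rewrite [leLHS]Re_normE rnormE lecR in h1.
  rewrite [leLHS]Re_normE rnormE lecR in h2.
  by apply: ler_pM => //; exact: Re_norm_ge0.
Qed.

End CompletedTensor.

(** * Lie ideals *)

Section Subspace.
Variables (K : fieldType) (E : lmodType K) (L : set E).
Hypothesis subL : is_subspace L.

Lemma subspaceD x y : L x -> L y -> L (x + y).
Proof. by move=> Lx Ly; have := subL.2 1 x y Lx Ly; rewrite scale1r. Qed.

Lemma subspaceZ k x : L x -> L (k *: x).
Proof. by move=> Lx; have := subL.2 k x 0 Lx subL.1; rewrite addr0. Qed.

Lemma subspaceN x : L x -> L (- x).
Proof. by rewrite -scaleN1r; apply: subspaceZ. Qed.

Lemma subspaceB x y : L x -> L y -> L (x - y).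
Proof. by move=> Lx Ly; apply: subspaceD => //; exact: subspaceN. Qed.

Lemma subspace_sum (I : eqType) (s : seq I) (F : I -> E) :
  (forall i, i \in s -> L (F i)) -> L (\sum_(i <- s) F i).
Proof.
move=> h; rewrite big_seq; elim/big_ind: _ => //; first exact: subL.1.
exact: subspaceD.
Qed.

End Subspace.

Section LieIdeals.
Variables (R : realType) (H : hilbertType R) (A : cstarAlgType R).
Variables (alpha : normfamily R) (e : A).
Hypothesis infH : infinite_dimensional H.
Hypothesis e_unit : forall a, cmul e a = a /\ cmul a e = a.
Hypothesis tn : is_tensor_norm alpha.
Hypothesis algn : is_algebra_norm alpha.
Local Notation K := (compactop H).
Local Notation C := (ctensor alpha A K).
Local Notation "x ** y" := (ctensor_mul x y) (at level 40, left associativity).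
Local Notation "a ⊗ k" := (pure alpha a k) (at level 39, no associativity).
Implicit Types (x y z : C) (a b c : A) (u v w : H) (k l : K) (s : seq H).

Let mul1a a : cmul e a = a. Proof. exact: (e_unit a).1. Qed.
Let mula1 a : cmul a e = a. Proof. exact: (e_unit a).2. Qed.
Let pureM := @pureM R alpha A K algn.
Let mulA := @ctensor_mulA R alpha A K algn.

Let unit_thetaM u v w : rnorm v = 1 -> cmul (theta u v) (theta v w) = theta u w.
Proof. by move=> v1; rewrite thetaM hdot_unit// scale1r. Qed.

Let ortho_thetaM u v w (y : H) : hdot w v = 0 ->
  cmul (theta u v) (theta w y) = 0.
Proof. by move=> wv; rewrite thetaM wv scale0r. Qed.

(** * Peirce corners and approximation by projections *)

Definition corner u : C := e ⊗ theta u u.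

Lemma corner_rnorm u : rnorm u = 1 -> rnorm (corner u) <= rnorm e.
Proof.
move=> u1; rewrite (le_trans (pure_rnorm_le tn _ _))//.
rewrite -[leRHS]mulr1 ler_wpM2l ?rnorm_ge0//.
by rewrite (le_trans (theta_rnorm _ _))// u1 mulr1.
Qed.

Lemma pure_proj_rnorm s : orthonormal_seq s -> rnorm (e ⊗ proj s) <= rnorm e.
Proof.
move=> os; rewrite (le_trans (pure_rnorm_le tn _ _))// -[leRHS]mulr1.
by rewrite ler_wpM2l ?rnorm_ge0// proj_rnorm.
Qed.

Lemma mul_contract x y z (r t : R) : rnorm x <= r -> rnorm z <= t ->
  rnorm (x ** y ** z) <= r * rnorm y * t.
Proof.
move=> xr zt; rewrite (le_trans (ctensor_mul_rnorm algn _ _))//.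
apply: ler_pM => //; try exact: rnorm_ge0.
rewrite (le_trans (ctensor_mul_rnorm algn _ _))//.
by rewrite ler_wpM2r ?rnorm_ge0.
Qed.

Lemma corner_sum_sandwich u v (t : seq (A * K)) :
  corner u ** (\sum_(p <- t) p.1 ⊗ p.2) ** corner v =
  (\sum_(p <- t) hdot (p.2 v) u *: p.1) ⊗ theta u v.
Proof.
elim: t => [|p t IH].
  by rewrite !big_nil ctensor_mul0r// ctensor_mul0l// pure0l.
rewrite !big_cons ctensor_mulDr// ctensor_mulDl// IH pureDl; congr (_ + _).
by rewrite !pureM mul1a mula1 theta_sandwich pureZr pureZl.
Qed.

(** The functional sending [k] to [hdot (k v) u] is contractive and takes the value 1 at
    [theta u v]. *)
Lemma le_pure_theta a u v : rnorm u = 1 -> rnorm v = 1 ->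
  rnorm a <= rnorm (a ⊗ theta u v).
Proof.
move=> u1 v1.
pose f k : R[i] := hdot (k v) u.
have lf : scalar f by move=> c k l; rewrite /f hdotDl hdotZl.
pose g : {scalar K} := HB.pack f (GRing.isLinear.Build _ _ _ _ f lf).
apply: (@le_pure_rnorm _ _ _ _ tn _ _ g).
  move=> k; rewrite Re_normE rnormE lecR (le_trans (hdot_cauchy_schwarz _ _))//.
  by rewrite u1 mulr1 (le_trans (compactop_bddby _ _))// v1 mulr1.
rewrite -[g _]/(hdot (theta u v v) u) thetaE hdotZl !hdot_unit// mulr1.
by rewrite normr1.
Qed.

(* The norming lower bound makes [a |-> a ⊗ theta u v] a homeomorphism onto its
   image, which is therefore complete. *)
Lemma corner_sandwich x u v : rnorm u = 1 -> rnorm v = 1 ->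
  exists a, corner u ** x ** corner v = a ⊗ theta u v.
Proof.
move=> u1 v1.
pose M := rnorm e * rnorm e + 1.
have M0 : 0 < M by rewrite ltr_wpDl// mulr_ge0 ?rnorm_ge0.
have approx (d : R) : 0 < d -> exists a,
    rnorm (corner u ** x ** corner v - a ⊗ theta u v) < d.
  move=> d0; have [t tx] := pure_sum_dense x (divr_gt0 d0 M0).
  exists (\sum_(p <- t) hdot (p.2 v) u *: p.1).
  rewrite -corner_sum_sandwich -ctensor_mulBl// -ctensor_mulBr//.
  apply: (le_lt_trans (mul_contract _ (corner_rnorm u1) (corner_rnorm v1))).
  move: tx; set y := x - _; rewrite ltr_pdivlMr// mulrAC.
  have := rnorm_ge0 y; move: (rnorm y) => r; rewrite /M; lra.
have /choice[a aP] : forall n : nat, exists a,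
    rnorm (corner u ** x ** corner v - a ⊗ theta u v) < n.+1%:R^-1.
  by move=> n; apply: approx; rewrite invr_gt0.
have [d d0|b ab] := @rcauchy_cvg _ _ a.
  have d2 : 0 < d / 2 by lra.
  have [N hN] := small_inv d2; exists N => m n Nm Nn.
  have h1 := lt_trans (aP m) (hN _ Nm); have h2 := lt_trans (aP n) (hN _ Nn).
  rewrite (le_lt_trans (le_pure_theta _ u1 v1))// pureBl.
  exact: rnorm_close h1 h2.
exists b; apply/eqP; rewrite -subr_eq0; apply/eqP/rnorm_eq0/eqP.
rewrite eq_le rnorm_ge0 andbT; apply/ler_addgt0Pl => d d0; rewrite addr0.
have d2 : 0 < d / 2 by lra.
have [[N hN] [N' hN']] := (small_inv d2, ab _ d2).
have h1 := lt_trans (aP _) (hN _ (leq_maxl N N')).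
have h2 := hN' _ (leq_maxr N N'); set n := maxn N N' in h1 h2.
rewrite rnormC in h1; apply/ltW; apply: rnorm_close h1 _.
rewrite -pureBl (le_lt_trans (pure_rnorm_le tn _ _))// (le_lt_trans _ h2)//.
rewrite -[leRHS]mulr1 ler_wpM2l ?rnorm_ge0//.
by rewrite (le_trans (theta_rnorm _ _))// u1 v1 mulr1.
Qed.

(** As [e] is the unit, [e ⊗ proj s] acts on the operator factors alone; the lists found for the
    single terms are concatenated. *)
Lemma pure_sum_approx (t : seq (A * K)) (d : R) : 0 < d ->
  exists ys : seq H, forall s, orthonormal_seq s ->
  (forall w, w \in ys -> proj s w = w) ->
  let y := \sum_(p <- t) p.1 ⊗ p.2 in
  rnorm (y - (e ⊗ proj s) ** y) <= d /\ rnorm (y - y ** (e ⊗ proj s)) <= d.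
Proof.
elim: t d => [|[a k] t IH] d d0.
  exists [::] => s _ _ /=; rewrite big_nil ctensor_mul0r// ctensor_mul0l//.
  by rewrite subr0 rnorm0 ltW.
have d2 : 0 < d / 2 by lra.
have a1 : 0 < rnorm a + 1 by rewrite ltr_wpDl ?rnorm_ge0.
have [ys ysP] := IH _ d2; have [zs zsP] := proj_approx k (divr_gt0 d2 a1).
exists (ys ++ zs) => s os sP /=.
have [|h1 h2] := ysP s os.
  by move=> y yys; apply: sP; rewrite mem_cat yys.
have [|h3 h4] := zsP s os.
  by move=> y yzs; apply: sP; rewrite mem_cat yzs orbT.
rewrite big_cons /=; move: h1 h2; set y := \sum_(p <- t) _ => h1 h2.
have half (l : K) : rnorm l <= d / 2 / (rnorm a + 1) -> rnorm (a ⊗ l) <= d / 2.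
  rewrite ler_pdivlMr// => hl; rewrite (le_trans (pure_rnorm_le tn _ _))//.
  rewrite (le_trans _ hl)// mulrC ler_wpM2l ?rnorm_ge0//.
  by rewrite lerDl.
rewrite ctensor_mulDr// ctensor_mulDl// !pureM mul1a mula1; split.
  by rewrite (le_trans (rnormDB _ _ _ _))// [d]splitr lerD// -pureBr half.
by rewrite (le_trans (rnormDB _ _ _ _))// [d]splitr lerD// -pureBr half.
Qed.

(** Finite sums are dense, and [rnorm e] bounds [e ⊗ proj s] uniformly in [s], so the approximation
    extends to the completion. *)
Lemma ctensor_approx x (d : R) : 0 < d ->
  exists ys : seq H, forall s, orthonormal_seq s ->
  (forall w, w \in ys -> proj s w = w) ->
  rnorm (x - (e ⊗ proj s) ** x) <= d /\ rnorm (x - x ** (e ⊗ proj s)) <= d.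
Proof.
move=> d0; have d2 : 0 < d / 2 by lra.
have M0 : 0 < rnorm e + 1 by rewrite ltr_wpDl ?rnorm_ge0.
have [t tx] := pure_sum_dense x (divr_gt0 d2 M0).
have [ys ysP] := pure_sum_approx t d2; exists ys => s os sP.
have [/= ] := ysP s os sP; move: tx; set y := \sum_(p <- t) _.
rewrite ltr_pdivlMr// => xy h1 h2.
have pe := pure_proj_rnorm os.
rewrite [d]splitr; split.
  apply: rnorm_transfer xy _ h1; rewrite -ctensor_mulBr//.
  rewrite (le_trans (ctensor_mul_rnorm algn _ _))//.
  by rewrite ler_wpM2r ?rnorm_ge0.
apply: rnorm_transfer xy _ h2; rewrite -ctensor_mulBl// mulrC.
rewrite (le_trans (ctensor_mul_rnorm algn _ _))//.
by rewrite ler_wpM2l ?rnorm_ge0.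
Qed.

Lemma corner_proj0 s v : (forall u, u \in s -> hdot u v = 0) ->
  corner v ** (e ⊗ proj s) = 0.
Proof.
move=> sv; rewrite pureM (_ : cmul _ (proj s) = 0) ?pure0r//.
apply: compactop_ext => x; rewrite kmulE thetaE [hdot _ _]hdot_eq0C ?scale0r//.
by apply: hdot_proj0 => u /sv; exact: hdot_eq0C.
Qed.

Let mulDl := @ctensor_mulDl R alpha A K algn.
Let mulDr := @ctensor_mulDr R alpha A K algn.
Let mulBl := @ctensor_mulBl R alpha A K algn.
Let mulBr := @ctensor_mulBr R alpha A K algn.

(** * The coefficient ideal of a closed Lie ideal *)

Variable L : set C.
Hypothesis closedL : closed L.
Hypothesis lieL : lie_ideal (@ctensor_mul R alpha A K) L.

Let subL : is_subspace L := lieL.1.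
Let lie x y : L y -> L (x ** y - y ** x).
Proof. exact: lieL.2. Qed.

Definition lie_coeff : set A := [set a | forall k, L (a ⊗ k)].

(** In the commutator with [c ⊗ theta w u] one product is the desired tensor, and the other vanishes
    because [w] is orthogonal to [v]. *)
Lemma lie_move_left a c u v w : rnorm u = 1 -> hdot w v = 0 ->
  L (a ⊗ theta u v) -> L (cmul c a ⊗ theta w v).
Proof.
move=> u1 wv /(lie (c ⊗ theta w u)).
by rewrite !pureM unit_thetaM// ortho_thetaM// pure0r subr0.
Qed.

Lemma lie_move_right a c u v w : rnorm v = 1 -> hdot u w = 0 ->
  L (a ⊗ theta u v) -> L (cmul a c ⊗ theta u w).
Proof.
move=> v1 uw /(lie (c ⊗ theta v w)); rewrite !pureM unit_thetaM//.
by rewrite ortho_thetaM// pure0r sub0r => /(subspaceN subL); rewrite opprK.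
Qed.

(* Off the diagonal the matrix units can be moved by commutators. On the
   diagonal commutators only give differences of diagonal units; averaging
   over [n] of them makes the error of order [1/n]. *)
Lemma lie_all_theta a : (forall u v, hdot u v = 0 -> L (a ⊗ theta u v)) ->
  forall u v, L (a ⊗ theta u v).
Proof.
move=> La u v; apply: closed_rnorm => // d d0.
pose M := complex.Re `|hdot u v| * rnorm a.
have M0 : 0 <= M by rewrite mulr_ge0 ?Re_norm_ge0 ?rnorm_ge0.
have d1 : 0 < d / (M + 1) by rewrite divr_gt0// ltr_wpDl.
have [N /(_ _ (leqnn N)) hN] := small_inv d1.
have [s [sN os sP]] := exists_orthonormal [:: u; v] N.+1 infH.
have n0 : (N.+1%:R : R[i]) != 0 by rewrite pnatr_eq0.
have Lsum : L (\sum_(f <- s) (a ⊗ theta u v - hdot u v *: (a ⊗ theta f f))).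
  apply: subspace_sum => // f fs.
  have f1 := orthonormal_unit os fs.
  have uf : hdot u f = 0 by apply: (sP f u); rewrite ?inE ?eqxx.
  (* The commutator of [e ⊗ theta f v] with [a ⊗ theta u f] is [hdot u v *: (a ⊗ theta f f) - a ⊗
     theta u v]. *)
  have := lie (e ⊗ theta f v) (La _ _ uf).
  rewrite !pureM mul1a mula1 unit_thetaM// thetaM pureZr => Lf.
  by have := subspaceN subL Lf; rewrite opprB.
exists (N.+1%:R^-1 *: \sum_(f <- s) (a ⊗ theta u v - hdot u v *: (a ⊗ theta f f))).
  exact: subspaceZ.
rewrite big_split/= sumrN -scaler_sumr.
rewrite big_const_seq count_predT sN iter_addr_0 -pure_sumr -/(proj s).
rewrite scalerBr -[(a ⊗ theta u v) *+ _]scaler_nat scalerA mulVf// scale1r.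
rewrite opprB addrCA subrr addr0 scalerA rnormZ Re_normM.
have -> : complex.Re `|N.+1%:R^-1 : R[i]| = N.+1%:R^-1.
  by rewrite -(rmorph_nat (real_complex R)) -fmorphV Re_norm_real// invr_ge0.
(* The error of the average is [N.+1%:R^-1 * hdot u v] times [a ⊗ proj s], and [proj s] has norm at
   most 1 whatever its rank. *)
apply: (@le_lt_trans _ _ (N.+1%:R^-1 * M)).
  rewrite -mulrA ler_wpM2l ?invr_ge0// ler_wpM2l ?Re_norm_ge0//.
  rewrite (le_trans (pure_rnorm_le tn _ _))// -[leRHS]mulr1.
  by rewrite ler_wpM2l ?rnorm_ge0// proj_rnorm.
move: hN; rewrite ltr_pdivlMr ?ltr_wpDl// => hN.
by rewrite (le_lt_trans _ hN)// ler_wpM2l ?invr_ge0// lerDl.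
Qed.

(** Compactness makes [cmul k (proj s)] close to [k], and this operator is a finite sum of terms
    [theta (k u) u]. *)
Lemma lie_all_compact a : (forall u v, L (a ⊗ theta u v)) -> lie_coeff a.
Proof.
move=> La k; apply: closed_rnorm => // d d0.
have a1 : 0 < rnorm a + 1 by rewrite ltr_wpDl ?rnorm_ge0.
have [ys ysP] := proj_approx k (divr_gt0 d0 a1).
have [s os sP] := gram_schmidt ys.
have [_ h] := ysP s os sP.
exists (a ⊗ cmul k (proj s)).
  rewrite (_ : cmul k (proj s) = \sum_(u <- s) theta (k u) u); last first.
    elim: (s) => [|u t IH].
      rewrite /proj !big_nil; apply: compactop_ext => x.
      exact: (linf0 (compactop_linear k)).
    by rewrite /proj !big_cons cmulDr kmul_theta -/(proj t) IH.
  by rewrite pure_sumr; apply: subspace_sum.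
rewrite -pureBr (le_lt_trans (pure_rnorm_le tn _ _))//.
rewrite (le_lt_trans (ler_wpM2l (rnorm_ge0 a) h))//.
by rewrite mulrA ltr_pdivrMr// mulrDr mulr1 mulrC ltrDl.
Qed.

(** A unit vector [f] orthogonal to [v] and [z] makes every move legitimate: [theta u v] goes to
    [theta f v], then to [theta f z], then to [theta w z]. The factor [c] enters on the left in the
    last move or on the right in the second. *)
Lemma lie_coeff_theta a c u v : rnorm u = 1 -> rnorm v = 1 ->
  L (a ⊗ theta u v) -> lie_coeff (cmul c a) /\ lie_coeff (cmul a c).
Proof.
move=> u1 v1 La.
split; apply/lie_all_compact/lie_all_theta => w z wz;
  have [f f1 fP] := exists_unit_orthogonal [:: v; z] infH;
  have fv : hdot f v = 0 by apply/hdot_eq0C/fP; rewrite ?inE ?eqxx.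
all: have fz : hdot f z = 0 by apply/hdot_eq0C/fP; rewrite ?inE ?eqxx ?orbT.
all: have := lie_move_left e u1 fv La; rewrite mul1a => Lfv.
  have := lie_move_right e v1 fz Lfv; rewrite mula1; exact: lie_move_left.
rewrite -[cmul a c]mul1a; apply: lie_move_left f1 wz _.
exact: lie_move_right v1 fz Lfv.
Qed.

Lemma lie_coeff_closed : closed lie_coeff.
Proof.
move=> a /closure_rnormP h k; apply: closed_rnorm => // d d0.
have k1 : 0 < rnorm k + 1 by rewrite ltr_wpDl ?rnorm_ge0.
have [b Lb ab] := h _ (divr_gt0 d0 k1); exists (b ⊗ k); first exact: Lb.
rewrite -pureBl (le_lt_trans (pure_rnorm_le tn _ _))//.
rewrite (le_lt_trans (ler_wpM2r (rnorm_ge0 k) (ltW ab)))//.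
by rewrite mulrAC ltr_pdivrMr// mulrDr mulr1 ltrDl.
Qed.

Lemma lie_coeff_ideal : is_ideal (@cmul R A) lie_coeff.
Proof.
split; first split=> [k|c a b La Lb k]; first by rewrite pure0l; exact: subL.1.
  by rewrite pureDl pureZl; exact: subL.2.
move=> c a La; have [u u1 _] := exists_unit_orthogonal [::] infH.
exact: (lie_coeff_theta c u1 u1 (La _)).
Qed.

(** * Corners of elements of the Lie ideal *)

Lemma peirce_off_diagonal x p q : p ** p = p -> p ** q = 0 -> q ** p = 0 ->
  L x -> L (p ** x ** q).
Proof.
move=> pp pq qp Lx.
(* This double commutator equals [- (p ** x ** q + q ** x ** p)]. *)
have L1 := lie p (lie q Lx).
have {}L1 : L (p ** x ** q + q ** x ** p).
  have := subspaceN subL L1; rewrite mulBr mulBl !mulA pq ctensor_mul0l// sub0r.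
  by rewrite -(mulA x q p) qp ctensor_mul0r// subr0 -opprD opprK.
(* A further commutator with [p] gives [p ** x ** q - q ** x ** p]; adding it to the sum leaves
   twice the corner. *)
have := subspaceD subL L1 (lie p L1).
rewrite mulDr mulDl !mulA pp pq !ctensor_mul0l// addr0.
rewrite -(mulA (p ** x) q p) qp ctensor_mul0r// add0r -(mulA (q ** x) p p) pp.
rewrite addrACA subrr addr0 => /(subspaceZ subL 2^-1).
rewrite -mulr2n -[(p ** x ** q) *+ 2]scaler_nat scalerA mulVf ?scale1r//.
by rewrite pnatr_eq0.
Qed.

Let cornerM u : rnorm u = 1 -> corner u ** corner u = corner u.
Proof. by move=> u1; rewrite /corner pureM mul1a unit_thetaM. Qed.

Let corner_ortho u v : hdot v u = 0 -> corner u ** corner v = 0.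
Proof. by move=> uv; rewrite /corner pureM ortho_thetaM// pure0r. Qed.

Lemma lie_corner_off x u v : rnorm u = 1 -> rnorm v = 1 -> hdot u v = 0 ->
  L x -> exists2 a, lie_coeff a & corner u ** x ** corner v = a ⊗ theta u v.
Proof.
move=> u1 v1 uv Lx; have vu := hdot_eq0C uv.
have [a aE] := corner_sandwich x u1 v1; exists a => //.
rewrite -[a]mula1; apply: (lie_coeff_theta e u1 v1 _).2.
by rewrite -aE; apply: peirce_off_diagonal => //; [exact: cornerM|
  exact: corner_ortho|exact: corner_ortho].
Qed.

(** Up to a small error [x] is [(e ⊗ proj s) ** x], and the corner at a unit vector [v] orthogonal
    to [s] annihilates that part. *)
Lemma corner_diag_small x u (d : R) : 0 < d -> exists v,
  [/\ rnorm v = 1, hdot u v = 0 & rnorm (corner v ** x ** corner v) < d].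
Proof.
move=> d0; have M0 : 0 < rnorm e * rnorm e + 1.
  by rewrite ltr_wpDl// mulr_ge0 ?rnorm_ge0.
have [ys ysP] := ctensor_approx x (divr_gt0 d0 M0).
have [s os sP] := gram_schmidt ys; have [h _] := ysP s os sP.
have [v v1 vP] := exists_unit_orthogonal (u :: s) infH.
exists v; split=> //; first by apply: vP; rewrite mem_head.
have -> : corner v ** x = corner v ** (x - (e ⊗ proj s) ** x).
  rewrite mulBr mulA corner_proj0 ?ctensor_mul0l ?subr0// => w ws.
  by apply: vP; rewrite inE ws orbT.
apply: (le_lt_trans (mul_contract _ (corner_rnorm v1) (corner_rnorm v1))).
rewrite mulrAC (le_lt_trans (ler_wpM2l _ h)) ?mulr_ge0 ?rnorm_ge0//.
by rewrite mulrA ltr_pdivrMr// mulrDr mulr1 mulrC ltrDl.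
Qed.

(** Modulo the closed set [lie_coeff], the coefficient [a] agrees with diagonal coefficients [b] of
    arbitrarily small norm. *)
Lemma lie_corner_diag x u : rnorm u = 1 -> L x ->
  exists2 a, lie_coeff a & corner u ** x ** corner u = a ⊗ theta u u.
Proof.
move=> u1 Lx; have [a aE] := corner_sandwich x u1 u1; exists a => //.
apply: lie_coeff_closed; apply/closure_rnormP => d d0.
have [v [v1 uv vd]] := corner_diag_small x u d0.
have [b bE] := corner_sandwich x v1 v1; rewrite bE in vd.
exists (a - b); last first.
  by rewrite opprB addrCA subrr addr0 (le_lt_trans (le_pure_theta _ v1 v1) vd).
rewrite -[a - b]mula1; apply: (lie_coeff_theta e u1 v1 _).2.
(* The negated commutator of [e ⊗ theta u v] with [x] has [(a - b) ⊗ theta u v] as its corner at [u]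
   and [v]. *)
have [c Lc cE] := lie_corner_off u1 v1 uv
  (subspaceN subL (lie (e ⊗ theta u v) Lx)).
rewrite (_ : _ ⊗ _ = c ⊗ theta u v)//.
have h1 : corner u ** (e ⊗ theta u v) = e ⊗ theta u v.
  by rewrite pureM mul1a unit_thetaM.
have h2 : (e ⊗ theta u v) ** corner v = e ⊗ theta u v.
  by rewrite pureM mul1a unit_thetaM.
have t1 : corner u ** x ** (e ⊗ theta u v) = a ⊗ theta u v.
  by rewrite -h1 mulA aE pureM mula1 unit_thetaM.
have t2 : (e ⊗ theta u v) ** x ** corner v = b ⊗ theta u v.
  by rewrite -[X in X ** x]h2 -!mulA (mulA (corner v) x) bE pureM mul1a unit_thetaM.
rewrite -cE opprB mulBr mulBl !mulA h1 t2 -(mulA (corner u ** x)) h2 t1.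
exact: pureBl.
Qed.

(** * Recovering the Lie ideal from its coefficients *)

Lemma tensor_subspace_pure (I : set A) a k : I a -> tensor_subspace I (a ⊗ k).
Proof.
move=> Ia; exists [:: (a, k)]; last by rewrite compl_embed_tensor_sum big_seq1.
by move=> p; rewrite inE => /eqP ->.
Qed.

Lemma tensor_subspaceD (I : set A) x y : tensor_subspace I x ->
  tensor_subspace I y -> tensor_subspace (alpha := alpha) (B := K) I (x + y).
Proof.
move=> [s sI <-] [t tI <-]; exists (s ++ t).
  by move=> p; rewrite mem_cat => /orP[/sI|/tI].
by rewrite !compl_embed_tensor_sum big_cat.
Qed.

Lemma tensor_subspace_sum (I : set A) (J : eqType) (s : seq J) (F : J -> C) :
  (forall i, i \in s -> tensor_subspace I (F i)) ->
  tensor_subspace I (\sum_(i <- s) F i).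
Proof.
move=> h; rewrite big_seq; elim/big_ind: _ => //; last exact: tensor_subspaceD.
by exists [::] => //; rewrite compl_embed_tensor_sum big_nil.
Qed.

Lemma lie_sub_closure : L `<=` closure (tensor_subspace lie_coeff).
Proof.
move=> x Lx; apply/closure_rnormP => d d0.
(* With [P = e ⊗ proj s], the error [x - P x P] splits into [x - P x] and [P (x - x P)], of total
   norm at most [rnorm e + 1] times [d / (rnorm e + 2)]. *)
have M0 : 0 < rnorm e + 2 by rewrite ltr_wpDl ?rnorm_ge0.
have [ys ysP] := ctensor_approx x (divr_gt0 d0 M0).
have [s os sP] := gram_schmidt ys; have [h1 h2] := ysP s os sP.
exists ((e ⊗ proj s) ** x ** (e ⊗ proj s)).
  (* Expanding both projections yields a finite sum of corners of [x]. *)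
  rewrite pure_sumr -/(corner _) ctensor_mul_suml// ctensor_mul_suml//.
  apply: tensor_subspace_sum => u us; rewrite ctensor_mul_sumr//.
  apply: tensor_subspace_sum => v vs; rewrite -/(corner u) -/(corner v).
  have [u1 v1] := (orthonormal_unit os us, orthonormal_unit os vs).
  have [->|uv] := orthonormal_ortho os us vs.
    by have [a La ->] := lie_corner_diag v1 Lx; exact: tensor_subspace_pure.
  by have [a La ->] := lie_corner_off u1 v1 uv Lx; exact: tensor_subspace_pure.
have := rnorm_tri ((e ⊗ proj s) ** x) x ((e ⊗ proj s) ** x ** (e ⊗ proj s)).
rewrite -[_ ** x ** _]mulA -mulBr => /le_lt_trans; apply.
have h3 := ctensor_mul_rnorm algn (e ⊗ proj s) (x - x ** (e ⊗ proj s)).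
have {}h3 := le_trans h3
  (ler_pM (rnorm_ge0 _) (rnorm_ge0 _) (pure_proj_rnorm os) h2).
apply: (le_lt_trans (lerD h1 h3)).
have -> : d / (rnorm e + 2) + rnorm e * (d / (rnorm e + 2)) =
  d * (rnorm e + 1) / (rnorm e + 2) by ring.
by rewrite ltr_pdivrMr// ltr_pM2l//; lra.
Qed.

Lemma tensor_subspace_lie : tensor_subspace lie_coeff `<=` L.
Proof.
move=> _ [t tI <-]; rewrite compl_embed_tensor_sum.
by apply: subspace_sum => // p /tI; exact.
Qed.

Lemma lie_eq_closure : L = closure (tensor_subspace lie_coeff).
Proof.
apply/seteqP; split; first exact: lie_sub_closure.
by move=> x /(closure_subset tensor_subspace_lie)/closedL.
Qed.

(** Density of finite sums reduces [x] to an elementary tensor, where the ideal property of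
    [lie_coeff] applies. *)
Lemma lie_coeff_mul x a k : lie_coeff a -> L (x ** (a ⊗ k)) /\ L ((a ⊗ k) ** x).
Proof.
move=> La.
have near (d : R) : 0 < d -> exists t : seq (A * K),
    rnorm (x - \sum_(p <- t) p.1 ⊗ p.2) * rnorm (a ⊗ k) < d.
  move=> d0; have k1 : 0 < rnorm (a ⊗ k) + 1 by rewrite ltr_wpDl ?rnorm_ge0.
  have [t ht] := pure_sum_dense x (divr_gt0 d0 k1); exists t.
  rewrite (le_lt_trans (ler_wpM2r (rnorm_ge0 _) (ltW ht)))//.
  by rewrite mulrAC ltr_pdivrMr// mulrDr mulr1 ltrDl.
split; apply: closed_rnorm => // d /near[t ht].
  exists ((\sum_(p <- t) p.1 ⊗ p.2) ** (a ⊗ k)).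
    rewrite ctensor_mul_suml//; apply: subspace_sum => // p _.
    by rewrite pureM; exact: (lie_coeff_ideal.2 _ _ La).1.
  by rewrite -mulBl (le_lt_trans (ctensor_mul_rnorm algn _ _)).
exists ((a ⊗ k) ** (\sum_(p <- t) p.1 ⊗ p.2)).
  rewrite ctensor_mul_sumr//; apply: subspace_sum => // p _.
  by rewrite pureM; exact: (lie_coeff_ideal.2 _ _ La).2.
by rewrite -mulBr (le_lt_trans (ctensor_mul_rnorm algn _ _))// mulrC.
Qed.

(** An element of [L] is a limit of sums of elementary tensors with coefficients in [lie_coeff];
    their products with [x] stay in the closed subspace [L]. *)
Lemma lie_ideal_ideal : is_ideal (@ctensor_mul R alpha A K) L.
Proof.
split=> // x y Ly.
have near (d : R) : 0 < d -> exists2 t : seq (A * K),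
    (forall p, p \in t -> lie_coeff p.1) &
    rnorm x * rnorm (y - \sum_(p <- t) p.1 ⊗ p.2) < d.
  move=> d0; have x1 : 0 < rnorm x + 1 by rewrite ltr_wpDl ?rnorm_ge0.
  have /closure_rnormP/(_ _ (divr_gt0 d0 x1))[_ [t tI <-]] := lie_sub_closure Ly.
  rewrite compl_embed_tensor_sum => ht; exists t => //.
  rewrite (le_lt_trans (ler_wpM2l (rnorm_ge0 _) (ltW ht)))//.
  by rewrite mulrA ltr_pdivrMr// mulrDr mulr1 mulrC ltrDl.
split; apply: closed_rnorm => // d /near[t tI ht].
  exists (x ** (\sum_(p <- t) p.1 ⊗ p.2)).
    rewrite ctensor_mul_sumr//; apply: subspace_sum => // p /tI Lp.
    exact: (lie_coeff_mul _ _ Lp).1.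
  by rewrite -mulBr (le_lt_trans (ctensor_mul_rnorm algn _ _)).
exists ((\sum_(p <- t) p.1 ⊗ p.2) ** x).
  rewrite ctensor_mul_suml//; apply: subspace_sum => // p /tI Lp.
  exact: (lie_coeff_mul _ _ Lp).2.
by rewrite -mulBl (le_lt_trans (ctensor_mul_rnorm algn _ _))// mulrC.
Qed.

End LieIdeals.

Theorem proposition6p2 (R : realType) (H : hilbertType R) (A : cstarAlgType R)
    (alpha : normfamily R) (L : set (ctensor alpha A (compactop H)))
    (sepH : separable H) (infH : infinite_dimensional H)
    (unitA : is_unital A)
    (alpha_tensor : is_tensor_norm alpha)
    (alpha_algebra : is_algebra_norm alpha)
    (alpha_cpu : cp_uniform alpha)
    (subL : is_subspace L) (closedL : closed L) :
  lie_ideal (@ctensor_mul R alpha A (compactop H)) L <->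
  is_ideal (@ctensor_mul R alpha A (compactop H)) L /\
  exists I : set A, [/\ closed I, is_ideal (@cmul R A) I
    & L = closure (@tensor_subspace R alpha A (compactop H) I)].
Proof.
have [e e_unit] := unitA; split=> [lieL|[[_ idL] _]]; last first.
  split=> // c x /(idL c)[Lcx Lxc]; exact: subspaceB.
split; first exact: (lie_ideal_ideal infH e_unit).
exists (lie_coeff L); split.
- exact: lie_coeff_closed.
- exact: (lie_coeff_ideal infH e_unit).
- exact: (lie_eq_closure infH e_unit).
Qed.
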